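(* Let $d=bD$, $A\in\mathbb{R}^{n\times d}$, $b'\in\mathbb{R}^n$, $f(x)=\|Ax-b'\|_2^2$, let $\mathcal{C}\subset\mathbb{R}^d$ be closed and convex, and let $\Psi$ be the FJLT (with parameter $m$). Let $x_*$ be a minimizer of $f$ over $\mathcal{C}$ and $\hat x$ a minimizer of $x\mapsto\|\Psi Ax-\Psi b'\|_2^2$ over $\mathcal{C}$. Let $\varepsilon\in(0,1/2)$, $\eta\in(0,1)$ and $$\beta=\big(\log^2(\eta^{-1})+\log b+\log n\big)\log(n)\log^3(b)\log^2(d).$$ If $$m\gtrsim\beta\varepsilon^{-2}|||A|||^2\Big[\sup_{x\in T_{\mathcal{C}}(x_* ):\ \|Ax\|_2=1}\|x\|_{2,1}^2\Big],$$ then with probability at least $1-\eta$, $f(\hat x)\le(1-\varepsilon)^{-2}f(x_* )$.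
   Context: $\gtrsim$ means $\ge$ up to a universal constant. Coordinates of $\mathbb{R}^d$ are partitioned into $b$ blocks $B_1,\dots,B_b$ of size $D$; $\|x\|_{2,1}=\sum_{\ell}\|x_{B_\ell}\|_2$ and $|||A|||=\max_{\ell}(\sum_{j=1}^n\sum_{k\in B_\ell}|A_{jk}|^2)^{1/2}$. $T_{\mathcal{C}}(x)$ is the tangent cone: the closed convex cone generated by $\{y-x:y\in\mathcal{C}\}$. FJLT: $\Psi=\Theta FD_\sigma$, where $F$ is the $n\times n$ unitary discrete Fourier transform (entries of modulus $n^{-1/2}$), $D_\sigma=\mathrm{diag}(\sigma_1,\dots,\sigma_n)$ with independent Rademachers $\sigma_i$, and $\Theta=\sqrt{n/m}\,\mathrm{diag}(\theta_1,\dots,\theta_n)$ with independent $\{0,1\}$-valued $\theta_i$, $\mathbb{P}(\theta_i=1)=m/n$, independent of $\sigma$.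
   Formalization: In β, log b, log n and log d are read as max(1, log ·): with the literal logarithm β = 0 when b = 1 or n = 1, the condition on m is void and the claim is false; for b, n ≥ 2 this only changes the universal constant. *)

(* Defs.v *)
From HB Require Import structures.
From mathcomp Require Import all_boot all_order all_algebra.
From mathcomp Require Import all_classical all_reals all_analysis.
From mathcomp.real_closed Require Export complex.

Set Implicit Arguments.
Unset Strict Implicit.
Unset Printing Implicit Defensive.

Import Order.TTheory GRing.Theory Num.Theory.
Import numFieldNormedType.Exports.

Local Open Scope classical_set_scope.
Local Open Scope ring_scope.

Definition l2norm (R : realType) (d : nat) (v : 'cV[R]_d) : R :=
  Num.sqrt (\sum_(i < d) v i 0 ^+ 2).

Definition l2normC (R : realType) (d : nat) (v : 'cV[R[i]]_d) : R :=
  Num.sqrt (\sum_(i < d) Normc.normc (v i 0) ^+ 2).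

Definition complexify (R : realType) (m n : nat) (A : 'M[R]_(m, n)) :
    'M[R[i]]_(m, n) :=
  map_mx (fun t : R => t%:C%C) A.

(* A partition of the d coordinates into b blocks is given by the map
   blk : 'I_d -> 'I_b sending a coordinate to the index of its block, so that
   B_l is the fibre of blk over l. *)
Definition block_partition (d b D : nat) (blk : 'I_d -> 'I_b) : Prop :=
  forall l : 'I_b, #|[set k : 'I_d | blk k == l]%SET| = D.

Definition norm21 (R : realType) (d b : nat) (blk : 'I_d -> 'I_b)
    (x : 'cV[R]_d) : R :=
  \sum_(l < b) Num.sqrt (\sum_(k < d | blk k == l) x k 0 ^+ 2).

(* |||A||| *)
Definition block_norm (R : realType) (n d b : nat) (blk : 'I_d -> 'I_b)
    (A : 'M[R]_(n, d)) : R :=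
  \big[Num.max/0]_(l < b)
    Num.sqrt (\sum_(j < n) \sum_(k < d | blk k == l) `|A j k| ^+ 2).

Definition closed_convex_cone (R : realType) (d : nat) (K : set 'cV[R]_d) :
    Prop :=
  [/\ closed K, convex_set K, K 0 &
      forall (t : R) (x : 'cV[R]_d), 0 <= t -> K x -> K (t *: x)].

Definition tangent_cone (R : realType) (d : nat) (C : set 'cV[R]_d)
    (x : 'cV[R]_d) : set 'cV[R]_d :=
  smallest (@closed_convex_cone R d) [set y - x | y in C].

Definition is_minimizer (R : realType) (d : nat) (g : 'cV[R]_d -> R)
    (C : set 'cV[R]_d) (x : 'cV[R]_d) : Prop :=
  C x /\ forall y, C y -> g x <= g y.

Definition lsq (R : realType) (n d : nat) (A : 'M[R]_(n, d)) (v : 'cV[R]_n)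
    (x : 'cV[R]_d) : R :=
  l2norm (A *m x - v) ^+ 2.

Definition sketched_lsq (R : realType) (n d : nat) (Psi : 'M[R[i]]_n)
    (A : 'M[R]_(n, d)) (v : 'cV[R]_n) (x : 'cV[R]_d) : R :=
  l2normC (Psi *m complexify A *m complexify x - Psi *m complexify v) ^+ 2.

(* F_{jk} = n^{-1/2} exp(- 2 i pi j k / n) *)
Definition dft (R : realType) (n : nat) : 'M[R[i]]_n :=
  \matrix_(j < n, k < n)
    (let t : R := 2 * pi * (j * k)%:R / n%:R in
     ((cos t / Num.sqrt n%:R) -i* (sin t / Num.sqrt n%:R))%C).

Definition fjlt (R : realType) (n : nat) (m : R) (sigma theta : 'I_n -> R) :
    'M[R[i]]_n :=
  complexify (Num.sqrt (n%:R / m) *: diag_mx (\row_i theta i))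
    *m dft R n *m complexify (diag_mx (\row_i sigma i)).

Definition mutually_independent (R : realType) (disp : measure_display)
    (T : measurableType disp) (P : probability T R) (I : finType)
    (X : I -> {RV P >-> R}) : Prop :=
  forall (J : {set I}) (S : I -> set R), (forall i, measurable (S i)) ->
    P (\bigcap_(i in [set` J]) (X i @^-1` S i)) =
    (\prod_(i in J) P (X i @^-1` S i))%E.

Definition rademacher (R : realType) (disp : measure_display)
    (T : measurableType disp) (P : probability T R) (X : {RV P >-> R}) : Prop :=
  [/\ forall w, X w = 1 \/ X w = -1,
      P (X @^-1` [set 1]) = (2^-1)%:E & P (X @^-1` [set -1]) = (2^-1)%:E].

Definition selector (R : realType) (disp : measure_display)
    (T : measurableType disp) (P : probability T R) (p : R)
    (X : {RV P >-> R}) : Prop :=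
  (forall w, X w = 0 \/ X w = 1) /\ P (X @^-1` [set 1]) = p%:E.

(* The sigma_i and theta_i are jointly independent: independent Rademachers,
   independent selectors, and the two families independent of each other. *)
Definition fjlt_randomness (R : realType) (disp : measure_display)
    (T : measurableType disp) (P : probability T R) (n : nat) (m : R)
    (sigma theta : 'I_n -> {RV P >-> R}) : Prop :=
  [/\ forall i, rademacher (sigma i),
      forall i, selector (m / n%:R) (theta i) &
      mutually_independent (fun k : 'I_n + 'I_n =>
        match k with inl i => sigma i | inr i => theta i end)].

(* With the plain logarithm, beta would vanish when b, n or d equals 1 and the
   lower bound on m would be void; log x is therefore read as max(1, ln x) for
   these integer arguments, which for b, n >= 2 changes beta only by a bounded
   factor. *)
Definition log1 (R : realType) (k : nat) : R := Num.max 1 (ln k%:R).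

Definition beta_factor (R : realType) (n b d : nat) (eta : R) : R :=
  (ln eta^-1 ^+ 2 + log1 R b + log1 R n) * log1 R n * log1 R b ^+ 3
    * log1 R d ^+ 2.

Definition cone_sup (R : realType) (n d b : nat) (blk : 'I_d -> 'I_b)
    (A : 'M[R]_(n, d)) (K : set 'cV[R]_d) : \bar R :=
  ereal_sup [set (norm21 blk x ^+ 2)%:E | x in
    [set x : 'cV[R]_d | K x /\ l2norm (A *m x) = 1]].

(* Main.v *)
Require Import Defs.
From mathcomp Require Import all_boot all_order all_algebra.
From mathcomp Require Import all_classical all_reals all_analysis.
From mathcomp Require Import zify ring lra.
Set Implicit Arguments.
Unset Strict Implicit.
Unset Printing Implicit Defensive.
Import Order.TTheory GRing.Theory Num.Theory.
Import numFieldNormedType.Exports.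
Local Open Scope ring_scope.

(** By first-order optimality of both minimizers, the theorem holds as soon as the
    sketch changes |Ax|^2 and <Ax, r> by at most eps on the normalized tangent
    cone, where r is the normalized residual at x_*.  Polarization reduces the
    cross term to quadratic forms after r has been appended to A as one more block.

    Khintchine moments show that, for most signs sigma, every block of every row
    a_j of sqrt(n) F D_sigma A has norm at most M, with
    M^2 of the order of |||A|||^2 log(n b / eta).  For such signs
    V = max_x |sum_j (theta_j - p) |<a_j, x>|^2| is symmetrized against an
    independent copy V' of V.  The Rademacher process thus obtained is bounded in
    L^(2q), with q of the order of log(1/eta), by chaining for the seminorm
    max_j |<a_j, x>|.  Its variance is controlled by the form itself, hence
    E V^(2q) <= G^q E (8 mu + V + V')^q, which can be solved for E V^(2q).

    The nets for the chaining come from mirror descent on the ball of the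
    (2,1)-norm: as long as some <a_j, x - y> exceeds u at the current iterate y,
    a step along a_j decreases a bounded potential by u^2/12.  Therefore x is
    determined up to 2u by O(log b / u^2) moves, each out of 4n+1 possibilities.
    This replaces dual Sudakov and Maurey estimates and costs no factor log d.
    Below the scale 1/d a grid is used.

    Since theta takes finitely many values, one distorted point per value of theta
    is all that has to be controlled, so every supremum is over a finite family. *)

(** * Moments of Rademacher sums *)

Lemma eq_leW (R : numDomainType) (a b : R) : a = b -> a <= b.
Proof. by move=> ->. Qed.

(** * Power mean inequalities for finite sums *)

Section PowerMeans.
Context {R : realFieldType}.

(** Chebyshev's association argument: the difference of the two sides is half the double sum of the
    [S i j], which are nonnegative because powers are monotone on nonnegative numbers. *)
Lemma chebyshev_sum_pow (T : finType) (w a : T -> R) (k : nat) :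
  (forall i, 0 <= w i) -> (forall i, 0 <= a i) ->
  (\sum_i w i * a i) * (\sum_i w i * a i ^+ k) <=
  (\sum_i w i) * \sum_i w i * a i ^+ k.+1.
Proof.
move=> w0 a0; rewrite -subr_ge0.
pose S i j := w i * w j * ((a i - a j) * (a i ^+ k - a j ^+ k)).
suff -> : (\sum_i w i) * (\sum_i w i * a i ^+ k.+1) -
    (\sum_i w i * a i) * (\sum_i w i * a i ^+ k) = 2^-1 * \sum_i \sum_j S i j.
  rewrite mulr_ge0 ?invr_ge0 ?ler0n // sumr_ge0 // => i _.
  rewrite sumr_ge0 // => j _; rewrite /S; apply: mulr_ge0; first exact: mulr_ge0.
  case: (leP (a i) (a j)) => [ij|/ltW ji].
    by apply: mulr_le0; rewrite subr_le0 // lerXn2r ?nnegrE.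
  by apply: mulr_ge0; rewrite subr_ge0 // lerXn2r ?nnegrE.
have E i j : S i j = (w i * (w j * a j ^+ k.+1) + w i * a i ^+ k.+1 * w j)
   - (w i * a i * (w j * a j ^+ k) + w i * a i ^+ k * (w j * a j)).
  by rewrite /S !exprS; ring.
have -> : \sum_i \sum_j S i j =
  \sum_i \sum_j w i * (w j * a j ^+ k.+1) +
  \sum_i \sum_j w i * a i ^+ k.+1 * w j -
  (\sum_i \sum_j w i * a i * (w j * a j ^+ k) +
   \sum_i \sum_j w i * a i ^+ k * (w j * a j)).
  under eq_bigr do (under eq_bigr do rewrite E);
  rewrite -!big_split -sumrB; apply: eq_bigr => i _ /=.
  by rewrite -!big_split -sumrB.
by rewrite -!big_distrlr /=; lra.
Qed.

(** Jensen's inequality for powers, by induction from the previous lemma. The weights are not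
    normalized, so it covers expectations, plain sums and sums weighted by variances. *)
Lemma sum_pow_le (T : finType) (w a : T -> R) (k : nat) :
  (forall i, 0 <= w i) -> (forall i, 0 <= a i) ->
  (\sum_i w i * a i) ^+ k.+1 <= (\sum_i w i) ^+ k * \sum_i w i * a i ^+ k.+1.
Proof.
move=> w0 a0; elim: k => [|k IH]; first by rewrite expr0 mul1r.
rewrite exprS; apply: (@le_trans _ _ ((\sum_i w i * a i) *
    ((\sum_i w i) ^+ k * \sum_i w i * a i ^+ k.+1))).
  by rewrite ler_wpM2l // sumr_ge0 // => i _; rewrite mulr_ge0.
rewrite mulrCA exprSr -mulrA ler_wpM2l ?exprn_ge0 ?sumr_ge0 //.
exact: chebyshev_sum_pow.
Qed.

Lemma sum_ord_pow_le (N k : nat) (a : 'I_N -> R) :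
  (\sum_i a i) ^+ (2 * k.+1) <= N%:R ^+ (2 * k).+1 * \sum_i a i ^+ (2 * k.+1).
Proof.
have ev (u : R) : u ^+ (2 * k.+1) = `|u| ^+ (2 * k.+1).
  by rewrite !exprM real_normK ?num_real.
rewrite ev; apply: (@le_trans _ _ ((\sum_i 1 * `|a i|) ^+ (2 * k.+1))).
  have -> : \sum_i 1 * `|a i| = \sum_i `|a i| by apply: eq_bigr => i _; rewrite mul1r.
  by apply: lerXn2r; rewrite ?nnegrE ?sumr_ge0 //; exact: ler_norm_sum.
have -> : \sum_i a i ^+ (2 * k.+1) = \sum_i 1 * `|a i| ^+ (2 * k.+1).
  by apply: eq_bigr => i _; rewrite mul1r -ev.
rewrite (_ : 2 * k.+1 = (2 * k).+2)%N ?mulnS //.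
by apply: le_trans (sum_pow_le _ _ _) _ => //; rewrite sumr_const card_ord.
Qed.

Lemma sqr_sum_le (T : finType) (a : T -> R) :
  (\sum_i a i) ^+ 2 <= #|T|%:R * \sum_i a i ^+ 2.
Proof.
have -> : \sum_i a i ^+ 2 = \sum_i 1 * `|a i| ^+ 2.
  by apply: eq_bigr => i _; rewrite mul1r real_normK ?num_real.
rewrite -(real_normK (num_real (\sum_i a i))).
apply: (@le_trans _ _ ((\sum_i 1 * `|a i|) ^+ 2)).
  have -> : \sum_i 1 * `|a i| = \sum_i `|a i| by apply: eq_bigr => i _; rewrite mul1r.
  by apply: lerXn2r; rewrite ?nnegrE ?sumr_ge0 //; exact: ler_norm_sum.
by apply: le_trans (sum_pow_le _ _ _) _ => //; rewrite sumr_const expr1.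
Qed.

(* Each of the [2q+1] terms [a^i b^(2q-i)] of the quotient is at most [a^2q + b^2q]. *)
Lemma mulr_sub_pow_le (a b : R) (q : nat) :
  (a - b) * (a ^+ (2 * q).+1 - b ^+ (2 * q).+1) <=
  (a - b) ^+ 2 * ((2 * q).+1%:R * (a ^+ (2 * q) + b ^+ (2 * q))).
Proof.
rewrite subrXX [leLHS]mulrA; apply: ler_wpM2l; first exact: sqr_ge0.
have -> : (2 * q).+1%:R * (a ^+ (2 * q) + b ^+ (2 * q)) =
  \sum_(i < (2 * q).+1) (a ^+ (2 * q) + b ^+ (2 * q)).
  by rewrite sumr_const card_ord mulr_natl.
apply: ler_sum => i _; rewrite [(2 * q).+1.-1]/=.
have ev (u : R) : u ^+ (2 * q) = `|u| ^+ (2 * q).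
  by rewrite !exprM real_normK ?num_real.
apply: le_trans (ler_norm _) _; rewrite normrM !normrX [in leRHS](ev a) [in leRHS](ev b).
have ile : (i <= 2 * q)%N by rewrite -ltnS.
case: (leP `|a| `|b|) => [ab|/ltW ba].
  rewrite (@le_trans _ _ (`|b| ^+ (2 * q))) ?lerDr ?exprn_ge0 //.
  by rewrite -[in leRHS](subnK ile) exprD; apply: ler_wpM2r; rewrite ?exprn_ge0 //; apply: lerXn2r; rewrite ?nnegrE.
rewrite (@le_trans _ _ (`|a| ^+ (2 * q))) ?lerDl ?exprn_ge0 //.
by rewrite -[in leRHS](subnK ile) exprD; apply: ler_wpM2l; rewrite ?exprn_ge0 //; apply: lerXn2r; rewrite ?nnegrE.
Qed.

End PowerMeans.

(** * Expectations over independent bits as finite sums *)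

Section BernoulliExpectation.
Context {R : realFieldType} {J : finType}.
Implicit Types (f g : {ffun J -> bool} -> R) (t e : {ffun J -> bool}) (p : R).

(** The weight of a bit pattern under the product Bernoulli law. Rademacher signs are the case of
    parameter 1/2, read through [sgn]. *)
Definition bern p t : R := \prod_j (if t j then p else 1 - p).

Definition Ex p f : R := \sum_t bern p t * f t.

Definition sgn (s : bool) : R := if s then 1 else -1.

Definition rsum (c : J -> R) e : R := \sum_j sgn (e j) * c j.

Lemma bern_ge0 p t : 0 <= p <= 1 -> 0 <= bern p t.
Proof.
by move=> /andP[p0 p1]; apply: prodr_ge0 => j _; case: ifP; rewrite ?subr_ge0.
Qed.

Lemma sum_bern p : \sum_t bern p t = 1.
Proof.
rewrite /bern -(bigA_distr_bigA (fun (_ : J) (s : bool) => if s then p else 1 - p)).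
by rewrite big1 // => j _; rewrite big_bool /= addrC subrK.
Qed.

Lemma Ex_cst p c : Ex p (fun=> c) = c.
Proof. by rewrite /Ex -mulr_suml sum_bern mul1r. Qed.

Lemma Ex_le p f g : 0 <= p <= 1 -> (forall t, f t <= g t) -> Ex p f <= Ex p g.
Proof. by move=> hp fg; apply: ler_sum => t _; rewrite ler_wpM2l ?bern_ge0. Qed.

Lemma Ex_ge0 p f : 0 <= p <= 1 -> (forall t, 0 <= f t) -> 0 <= Ex p f.
Proof. by move=> hp f0; rewrite -(Ex_cst p 0); apply: Ex_le. Qed.

Lemma ExD p f g : Ex p (fun t => f t + g t) = Ex p f + Ex p g.
Proof. by rewrite /Ex -big_split; apply: eq_bigr => t _; rewrite mulrDr. Qed.

Lemma ExZ p c f : Ex p (fun t => c * f t) = c * Ex p f.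
Proof. by rewrite /Ex mulr_sumr; apply: eq_bigr => t _; rewrite mulrCA. Qed.

Lemma eq_Ex p f g : f =1 g -> Ex p f = Ex p g.
Proof. by move=> fg; apply: eq_bigr => t _; rewrite fg. Qed.

Lemma Ex_sum p (K : finType) (F : K -> {ffun J -> bool} -> R) :
  Ex p (fun t => \sum_k F k t) = \sum_k Ex p (F k).
Proof.
by rewrite /Ex exchange_big; apply: eq_bigr => t _; rewrite mulr_sumr.
Qed.

Lemma Ex_sum_in p (K : finType) (A : {set K}) (F : K -> {ffun J -> bool} -> R) :
  Ex p (fun t => \sum_(k in A) F k t) = \sum_(k in A) Ex p (F k).
Proof.
by rewrite /Ex exchange_big; apply: eq_bigr => t _; rewrite mulr_sumr.
Qed.

Lemma Ex_pow_le p f k : 0 <= p <= 1 -> (forall t, 0 <= f t) ->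
  (Ex p f) ^+ k <= Ex p (fun t => f t ^+ k).
Proof.
move=> hp f0; case: k => [|k]; first by rewrite expr0 Ex_cst.
by have := sum_pow_le k (fun t => bern_ge0 t hp) f0; rewrite sum_bern expr1n mul1r.
Qed.

Lemma Ex_bit p j : Ex p (fun t => (t j)%:R) = p.
Proof.
pose F (i : J) (s : bool) : R :=
  (if s then p else 1 - p) * (if i == j then s%:R else 1).
have -> : Ex p (fun t => (t j)%:R) = \sum_(t : {ffun J -> bool}) \prod_i F i (t i).
  apply: eq_bigr => t _; rewrite /F big_split; congr (_ * _) => /=.
  by rewrite -big_mkcond big_pred1_eq.
rewrite -(bigA_distr_bigA F) (bigD1 j) //= big_bool /F eqxx /= mulr1 mulr0 addr0.
by rewrite big1 ?mulr1 // => i /negbTE ->; rewrite big_bool /= !mulr1 addrC subrK.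
Qed.

Lemma Ex_half_reindex (h : {ffun J -> bool} -> {ffun J -> bool}) f :
  involutive h -> Ex 2^-1 (f \o h) = Ex 2^-1 f.
Proof.
move=> hK; have bc t : bern 2^-1 t = 2^-1 ^+ #|J|.
  rewrite /bern -prodr_const; apply: eq_bigr => j _; case: ifP => // _; lra.
rewrite /Ex [RHS](reindex_inj (inv_inj hK)) /=.
by apply: eq_bigr => t _; rewrite !bc.
Qed.

Lemma markov p f c (D : pred {ffun J -> bool}) : 0 <= p <= 1 -> 0 < c ->
  (forall t, 0 <= f t) -> (forall t, D t -> c <= f t) ->
  \sum_(t | D t) bern p t <= Ex p f / c.
Proof.
move=> hp c0 f0 Df; rewrite ler_pdivlMr // mulr_suml /Ex [leRHS](bigID D) /=.
rewrite -[leLHS]addr0; apply: lerD; last first.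
  by rewrite sumr_ge0 // => t _; rewrite mulr_ge0 ?bern_ge0.
by apply: ler_sum => t /Df; apply: ler_wpM2l; exact: bern_ge0.
Qed.

Let half01 : (0 <= (2^-1 : R) <= 1).
Proof. by rewrite invr_ge0 ler0n invf_le1 ?ltr0n // ler1n. Qed.

(** Integration by parts on the cube: one factor of the power is expanded into the
    [sgn (e j) * c j]. Averaging each term over a flip of the bit [j] leaves a difference of odd
    powers, to which [mulr_sub_pow_le] applies; [4 * q.+1] bounds [2 * (2 * q).+1]. *)
Lemma rademacher_moment_step (c : J -> R) (q : nat) :
  Ex 2^-1 (fun e => rsum c e ^+ (2 * q.+1)) <=
  (4 * q.+1%:R) * (\sum_j c j ^+ 2) * Ex 2^-1 (fun e => rsum c e ^+ (2 * q)).
Proof.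
set S := rsum c.
pose flip j (e : {ffun J -> bool}) := [ffun i => if i == j then ~~ e i else e i].
have flipK j : involutive (flip j).
  by move=> e; apply/ffunP => i; rewrite !ffunE; case: (i == j); rewrite ?negbK.
have Sflip j e : S e - S (flip j e) = 2 * (sgn (e j) * c j).
  rewrite /S /rsum -sumrB (bigD1 j) //= big1 ?addr0 => [|i /negbTE ij].
    by rewrite ffunE eqxx /sgn; case: (e j) => /=; ring.
  by rewrite ffunE ij subrr.
have -> : Ex 2^-1 (fun e => S e ^+ (2 * q.+1)) =
   \sum_j Ex 2^-1 (fun e => sgn (e j) * c j * S e ^+ (2 * q).+1).
  rewrite -Ex_sum; apply: eq_Ex => e; rewrite -mulr_suml -/(S e) -exprS.
  by congr (_ ^+ _); rewrite mulnS.
rewrite -mulrA mulrCA mulr_suml; apply: ler_sum => j _.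
pose F e := sgn (e j) * c j * S e ^+ (2 * q).+1.
have half : Ex 2^-1 F = Ex 2^-1 (fun e => 2^-1 * (F e + F (flip j e))).
  rewrite ExZ ExD (Ex_half_reindex F (flipK j)); lra.
rewrite -/F half -!ExZ.
apply: (@le_trans _ _ (Ex 2^-1 (fun e => c j ^+ 2 * (2 * q).+1%:R *
   (S e ^+ (2 * q) + S (flip j e) ^+ (2 * q))))); last first.
  rewrite ExZ ExD (Ex_half_reindex (fun e => S e ^+ (2 * q)) (flipK j)) !ExZ.
  have /= X0 : 0 <= Ex 2^-1 (fun e => S e ^+ (2 * q)).
    by apply: Ex_ge0 => // e; rewrite exprM exprn_ge0 ?sqr_ge0.
  set X := Ex _ _ in X0 *.
  have -> : c j ^+ 2 * (2 * q).+1%:R * (X + X) = (2 * (2 * q).+1%:R) * (c j ^+ 2 * X).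
    ring.
  have -> : c j ^+ 2 * (4 * q.+1%:R * X) = (4 * q.+1%:R) * (c j ^+ 2 * X) by ring.
  apply: ler_wpM2r; first by rewrite mulr_ge0 ?sqr_ge0.
  rewrite -!natrM ler_nat mulnS; lia.
apply: Ex_le => // e.
have := mulr_sub_pow_le (S e) (S (flip j e)) q; rewrite Sflip /F !ffunE eqxx.
set a := S e; set b := S _.
have -> : sgn (~~ e j) = - sgn (e j) by rewrite /sgn; case: (e j) => /=; ring.
have s2 : sgn (e j) ^+ 2 = 1 by rewrite /sgn; case: (e j); rewrite ?sqrrN expr1n.
set X := a ^+ _.+1; set Y := b ^+ _.+1; set Z := a ^+ _ + b ^+ _.
set u := sgn _ in s2 *; set N := (2 * q).+1%:R => H.
have E : (2 * (u * c j)) ^+ 2 * (N * Z) = 2 * (2 * (c j ^+ 2 * N * Z)).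
  by rewrite !exprMn s2; ring.
by move: H; rewrite E; lra.
Qed.

(** Khintchine's inequality: the one-step bound is iterated, all earlier factors being raised to the
    last one. *)
Lemma rademacher_moment (c : J -> R) (q : nat) :
  Ex 2^-1 (fun e => rsum c e ^+ (2 * q)) <=
  (4 * q%:R * \sum_j c j ^+ 2) ^+ q.
Proof.
have s0 : 0 <= \sum_j c j ^+ 2 by apply: sumr_ge0 => j _; exact: sqr_ge0.
elim: q => [|q IH]; first by rewrite muln0 Ex_cst expr0.
apply: le_trans (rademacher_moment_step c q) _; rewrite exprS.
have q0 : 0 <= 4 * q.+1%:R * \sum_j c j ^+ 2.
  by rewrite mulr_ge0 // mulr_ge0 ?ler0n.
apply: ler_wpM2l => //; apply: le_trans IH _.
rewrite lerXn2r ?nnegrE //; first by rewrite mulr_ge0 // mulr_ge0 ?ler0n.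
by rewrite ler_wpM2r // ler_wpM2l ?ler0n // ler_nat.
Qed.

(* Raising to the further power [r] makes the union bound over the labels cost
   only a constant factor as soon as [log2 N <= q r]. *)
Lemma rademacher_sup_moment (L : finType) (A : {set L}) (g : L -> J -> R)
    (l : {ffun J -> bool} -> L) (s2 : R) (q r : nat) :
  (0 < r)%N -> 0 <= s2 -> (forall e, l e \in A) ->
  (forall k, k \in A -> \sum_j g k j ^+ 2 <= s2) -> (#|A| <= 2 ^ (q * r))%N ->
  Ex 2^-1 (fun e => rsum (g (l e)) e ^+ (2 * q)) <=
  (8 * (q * r)%:R * s2) ^+ q.
Proof.
move=> r0 s20 lA gs cA.
pose X e := rsum (g (l e)) e ^+ (2 * q).
have X0 e : 0 <= X e by rewrite /X exprM exprn_ge0 ?sqr_ge0.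
have B0 : 0 <= 8 * (q * r)%:R * s2 by rewrite mulr_ge0 // mulr_ge0 ?ler0n.
rewrite -/X -(@ler_pXn2r _ r) ?nnegrE ?exprn_ge0 ?Ex_ge0 //.
apply: le_trans (Ex_pow_le _ half01 X0) _.
pose F k e : R := rsum (g k) e ^+ (2 * (q * r)).
have F0 k e : 0 <= F k e by rewrite /F exprM exprn_ge0 ?sqr_ge0.
apply: (@le_trans _ _ (Ex 2^-1 (fun e => \sum_(k in A) F k e))).
  apply: Ex_le => // e; rewrite (bigD1 (l e)) //= -[leLHS]addr0.
  by rewrite lerD ?sumr_ge0 // /X -exprM -mulnA.
rewrite Ex_sum_in.
apply: (@le_trans _ _ (\sum_(k in A) (4 * (q * r)%:R * s2) ^+ (q * r))).
  apply: ler_sum => k kA; apply: le_trans (rademacher_moment _ _) _.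
  have s0 : 0 <= \sum_j g k j ^+ 2 by apply: sumr_ge0 => j _; exact: sqr_ge0.
  have q0 : 0 <= 4 * (q * r)%:R :> R by rewrite mulr_ge0 ?ler0n.
  by apply: lerXn2r; rewrite ?nnegrE ?mulr_ge0 // ler_wpM2l ?gs.
rewrite sumr_const -[leLHS]mulr_natl -exprM.
have -> : 8 * (q * r)%:R * s2 = 2 * (4 * (q * r)%:R * s2) by ring.
rewrite [leRHS]exprMn; apply: ler_wpM2r; rewrite ?exprn_ge0 //; last by rewrite -natrX ler_nat.
by rewrite mulr_ge0 // mulr_ge0 ?ler0n.
Qed.

End BernoulliExpectation.

(** * Mirror descent nets *)

(** Lagrange's identity writes the difference as half a double sum of squares. *)
Lemma cauchy_schwarz_sum (R : realFieldType) (T : finType) (P : pred T)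
    (a b : T -> R) :
  (\sum_(k | P k) a k * b k) ^+ 2 <=
  (\sum_(k | P k) a k ^+ 2) * (\sum_(k | P k) b k ^+ 2).
Proof.
rewrite -subr_ge0.
suff -> : (\sum_(k | P k) a k ^+ 2) * (\sum_(k | P k) b k ^+ 2) -
   (\sum_(k | P k) a k * b k) ^+ 2 =
   2^-1 * \sum_(i | P i) \sum_(j | P j) (a i * b j - a j * b i) ^+ 2.
  rewrite mulr_ge0 ?invr_ge0 ?ler0n // sumr_ge0 // => i _.
  by rewrite sumr_ge0 // => j _; exact: sqr_ge0.
have E i j : (a i * b j - a j * b i) ^+ 2 = a i ^+ 2 * b j ^+ 2 +
    b i ^+ 2 * a j ^+ 2 - 2 * ((a i * b i) * (a j * b j)) by ring.
have -> : \sum_(i | P i) \sum_(j | P j) (a i * b j - a j * b i) ^+ 2 =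
  \sum_(i | P i) \sum_(j | P j) a i ^+ 2 * b j ^+ 2 +
  \sum_(i | P i) \sum_(j | P j) b i ^+ 2 * a j ^+ 2 -
  2 * \sum_(i | P i) \sum_(j | P j) (a i * b i) * (a j * b j).
  rewrite mulr_sumr -big_split -sumrB; apply: eq_bigr => i _ /=.
  rewrite mulr_sumr -big_split -sumrB; apply: eq_bigr => j _ /=.
  by rewrite E.
by rewrite -!big_distrlr /= expr2; lra.
Qed.

Lemma sqrt_le_of_sqr (R : rcfType) (s v : R) : 0 <= v -> s <= v ^+ 2 -> Num.sqrt s <= v.
Proof. by move=> v0 sv; rewrite -(ger0_norm v0) -sqrtr_sqr ler_wsqrtr. Qed.

(** Since [expR (- s) >= 1 - s], the exponential is at most [1 / (1 - s)], and
    [(1 + s + 2 * s ^+ 2) * (1 - s)] equals [1 + s ^+ 2 * (1 - 2 * s)]. *)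
Lemma expR_le_quad (R : realType) (s : R) : s <= 2^-1 -> expR s <= 1 + s + 2 * s ^+ 2.
Proof.
move=> s2; have h := expR_ge1Dx (- s); have e0 := expR_gt0 s.
have : expR s * expR (- s) = 1 by rewrite -expRD subrr expR0.
set E := expR s in e0 *; set F := expR (- s) in h * => EF.
have q0 : 0 <= s ^+ 2 * (1 - 2 * s).
  by rewrite mulr_ge0 ?sqr_ge0 //; lra.
have h1 : E * (1 - s) <= 1.
  by rewrite -EF ler_wpM2l //; [exact: ltW | lra].
have s1 : 0 < 1 - s by lra.
by rewrite -(ler_pM2r s1); apply: le_trans h1 _; lra.
Qed.

(** * The (2,1)-norm and a smooth potential for its dual norm *)

Section BlockNorms.
Context {R : realType} {I B : finType} (blk : I -> B).
Implicit Types x y z r h : I -> R.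

Definition dot x y : R := \sum_k x k * y k.

Definition block_sq x (l : B) : R := \sum_(k | blk k == l) x k ^+ 2.

Definition sum_norm x : R := \sum_l Num.sqrt (block_sq x l).

Lemma block_sq_ge0 x l : 0 <= block_sq x l.
Proof. by apply: sumr_ge0 => k _; exact: sqr_ge0. Qed.

Lemma block_dot_le x y (l : B) (c : R) : 0 <= c -> block_sq x l <= c ^+ 2 ->
  `|\sum_(k | blk k == l) x k * y k| <= c * Num.sqrt (block_sq y l).
Proof.
move=> c0 xc; rewrite -sqrtr_sqr; apply: sqrt_le_of_sqr.
  by rewrite mulr_ge0 ?sqrtr_ge0.
rewrite exprMn sqr_sqrtr ?block_sq_ge0 //.
by apply: le_trans (cauchy_schwarz_sum _ _ _) _; rewrite ler_wpM2r ?block_sq_ge0.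
Qed.

Lemma dot_blocks x y : dot x y = \sum_l \sum_(k | blk k == l) x k * y k.
Proof. by rewrite /dot (partition_big blk predT). Qed.

Lemma normr_dot_le x y (c : R) : 0 <= c -> (forall l, block_sq x l <= c ^+ 2) ->
  `|dot x y| <= c * sum_norm y.
Proof.
move=> c0 xc; rewrite dot_blocks mulr_sumr.
by apply: le_trans (ler_norm_sum _ _ _) _; apply: ler_sum => l _; exact: block_dot_le.
Qed.

(** A smooth substitute for the norm of a block: the 1 under the root removes the singularity at
    zero and bounds the value below. *)
Definition block_weight z l : R := Num.sqrt (1 + block_sq z l).

(** Its logarithm is a soft maximum of the block weights, hence a smooth upper bound for the norm
    dual to [sum_norm]. *)
Definition potential z : R := \sum_l expR (block_weight z l).

(* The gradient of [ln (potential z)]. *)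
Definition mirror_point z : I -> R := fun k =>
  expR (block_weight z (blk k)) / potential z * (z k / block_weight z (blk k)).

Lemma block_weight_ge1 z l : 1 <= block_weight z l.
Proof.
by rewrite -[leLHS]sqrtr1 ler_wsqrtr // lerDl block_sq_ge0.
Qed.

Lemma block_weight_sqr z l : block_weight z l ^+ 2 = 1 + block_sq z l.
Proof. by rewrite sqr_sqrtr // addr_ge0 ?block_sq_ge0. Qed.

Lemma sqrt_block_sq_le z l : Num.sqrt (block_sq z l) <= block_weight z l.
Proof. by rewrite ler_wsqrtr // lerDr. Qed.

Lemma potential_ge z l : expR (block_weight z l) <= potential z.
Proof.
by rewrite /potential (bigD1 l) //= lerDl sumr_ge0 // => i _; exact: expR_ge0.
Qed.

(** Second order expansion of the square root. After squaring, [a ^+ 2 / 2] contributes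
    [block_weight z l * a ^+ 2], which covers [block_sq h l] because the weight is at least 1. *)
Lemma block_weight_step z h (a : R) (l : B) : 0 <= a <= 6^-1 ->
  block_sq h l <= a ^+ 2 ->
  let t := (\sum_(k | blk k == l) z k * h k) / block_weight z l in
  `|t| <= a /\ block_weight (fun k => z k + h k) l <= block_weight z l + t + a ^+ 2 / 2.
Proof.
move=> /andP[a0 a6] ha t; have p1 := block_weight_ge1 z l.
have p0 : 0 < block_weight z l by apply: lt_le_trans p1.
have tE : t * block_weight z l = \sum_(k | blk k == l) z k * h k.
  by rewrite /t divfK ?gt_eqF.
have ta : `|t| <= a.
  rewrite -(ler_pM2r p0) -{1}(gtr0_norm p0) -normrM tE.
  have -> : \sum_(k | blk k == l) z k * h k = \sum_(k | blk k == l) h k * z k.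
    by apply: eq_bigr => k _; rewrite mulrC.
  apply: le_trans (block_dot_le _ a0 ha) _.
  by rewrite ler_wpM2l ?sqrt_block_sq_le.
split=> //; have := ta; rewrite ler_norml => /andP[t1 t2].
have a2 := sqr_ge0 a.
apply: sqrt_le_of_sqr; first by lra.
have -> : block_sq (fun k => z k + h k) l = block_sq z l +
    2 * (t * block_weight z l) + block_sq h l.
  rewrite tE mulr_sumr -!big_split; apply: eq_bigr => k _ /=; ring.
have w2 := block_weight_sqr z l.
set p := block_weight z l in p1 p0 w2 *.
have s0 := sqr_ge0 (t + a ^+ 2 / 2).
have pa : a ^+ 2 <= p * a ^+ 2 by rewrite ler_peMl.
have -> : (p + t + a ^+ 2 / 2) ^+ 2 =
  p ^+ 2 + 2 * (t * p) + p * a ^+ 2 + (t + a ^+ 2 / 2) ^+ 2 by field.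
by lra.
Qed.

(** Smoothness of the soft maximum: each exponential grows at most by the factor
    [1 + t l + 3 * a ^+ 2], and the average of [t] weighted by the exponentials is the pairing of
    [mirror_point z] with [h]. *)
Lemma ln_potential_step z h (a : R) (l0 : B) : 0 <= a <= 6^-1 ->
  (forall l, block_sq h l <= a ^+ 2) ->
  ln (potential (fun k => z k + h k)) <=
  ln (potential z) + dot (mirror_point z) h + 3 * a ^+ 2.
Proof.
move=> ha hh; pose t l := (\sum_(k | blk k == l) z k * h k) / block_weight z l.
have W0 : 0 < potential z.
  by apply: lt_le_trans (potential_ge z l0); exact: expR_gt0.
have W0' : 0 < potential (fun k => z k + h k).
  by apply: lt_le_trans (potential_ge _ l0); exact: expR_gt0.
have dE : dot (mirror_point z) h * potential z =
    \sum_l expR (block_weight z l) * t l.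
  rewrite dot_blocks mulr_suml; apply: eq_bigr => l _.
  rewrite mulr_suml /t mulr_suml mulr_sumr; apply: eq_bigr => k /eqP kl.
  rewrite /mirror_point kl; set E := expR _; set P := potential _ in W0 *.
  by rewrite -[RHS](mulfVK (lt0r_neq0 W0)); ring.
have le1 : potential (fun k => z k + h k) <=
    potential z * expR (dot (mirror_point z) h + 3 * a ^+ 2).
  apply: (@le_trans _ _ (\sum_l expR (block_weight z l) * (1 + t l + 3 * a ^+ 2))).
    apply: ler_sum => l _.
    have [ta wl] := block_weight_step z ha (hh l).
    have {}wl : block_weight (fun k => z k + h k) l <=
      block_weight z l + (t l + a ^+ 2 / 2) by rewrite addrA.
    apply: le_trans (_ : _ <= expR (block_weight z l + (t l + a ^+ 2 / 2))) _.
      by rewrite ler_expR.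
    rewrite expRD ler_wpM2l ?expR_ge0 //.
    have {}ta : `|t l| <= a by [].
    move: ta; rewrite ler_norml => /andP[t1 t2]; case/andP: ha => a0 a6.
    have a26 : a ^+ 2 <= a / 6 by rewrite expr2 ler_wpM2l.
    have a20 := sqr_ge0 a.
    apply: le_trans (expR_le_quad _) _; first by lra.
    (* Since [a <= 1/6], the exponent has modulus at most [13/12 * a]; the constant 3 exceeds
       [1/2 + 2 * (13/12) ^+ 2]. *)
    have : (t l + a ^+ 2 / 2) ^+ 2 <= (a + a / 12) ^+ 2.
      rewrite -ler_sqrt ?sqr_ge0 // !sqrtr_sqr [leRHS]ger0_norm; last by lra.
      by rewrite ler_norml; apply/andP; split; lra.
    by rewrite (_ : a + a / 12 = (13 / 12) * a) ?exprMn; [lra|field].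
  have -> : \sum_l expR (block_weight z l) * (1 + t l + 3 * a ^+ 2) =
     potential z * (1 + (dot (mirror_point z) h + 3 * a ^+ 2)).
    rewrite addrA mulrDr mulrDr mulr1 [X in _ = _ + X + _]mulrC dE /potential.
    rewrite mulr_suml -!big_split; apply: eq_bigr => l _ /=; ring.
  by rewrite ler_wpM2l ?(ltW W0) ?expR_ge1Dx.
apply: le_trans (_ : _ <= ln (potential z * expR (dot (mirror_point z) h + 3 * a ^+ 2))) _.
  by rewrite ler_ln // posrE ?mulr_gt0 ?expR_gt0.
by rewrite lnM ?posrE ?expR_gt0 // expRK addrA.
Qed.

(** The Fenchel gap of the soft maximum at [x]. Its gradient in [z] is [mirror_point z - x], so a
    row on which [x] and the mirror point disagree is a descent direction. *)
Definition gap z x : R := ln (potential z) - dot z x.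

(** The soft maximum dominates every block norm of [z], hence the pairing of [z] with any point of
    the unit ball. *)
Lemma gap_ge0 z x (l0 : B) : sum_norm x <= 1 -> 0 <= gap z x.
Proof.
move=> x1; rewrite subr_ge0.
have W0 : 0 < potential z.
  by apply: lt_le_trans (potential_ge z l0); exact: expR_gt0.
have w l : block_weight z l <= ln (potential z).
  by rewrite -[leLHS]expRK ler_ln ?potential_ge // posrE ?expR_gt0.
have lnW0 : 0 <= ln (potential z).
  by apply: le_trans (w l0); apply: le_trans (block_weight_ge1 _ _).
apply: le_trans (ler_norm _) _.
apply: le_trans (normr_dot_le (c := ln (potential z)) _ lnW0 _) _ => [l|].
  rewrite -[leLHS]sqr_sqrtr ?block_sq_ge0 // lerXn2r ?nnegrE ?sqrtr_ge0 //.
  by apply: le_trans (w l); exact: sqrt_block_sq_le.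
by rewrite ler_piMr.
Qed.

Lemma gap0 x : gap (fun=> 0) x = ln (#|B|%:R * expR 1).
Proof.
rewrite /gap /dot big1 ?subr0 => [|k _]; last by rewrite mul0r.
congr ln; rewrite /potential /block_weight /block_sq -sum1_card natr_sum mulr_suml.
apply: eq_bigr => l _; rewrite mul1r; congr expR.
by rewrite big1 ?addr0 ?sqrtr1 // => k _; rewrite expr0n.
Qed.

(** * Covering numbers from transcripts of the descent *)

Section Covering.
Context {I2 : finType} (r : I2 -> I -> R) (u : R) (l0 : B).
Hypothesis r1 : forall i l, block_sq (r i) l <= 1.
Hypothesis u01 : 0 < u <= 1.

Let move_vec (m : I2 * bool) : I -> R := fun k => sgn m.2 * (u / 6) * r m.1 k.

Let violated z x (m : I2 * bool) : bool :=
  u < sgn m.2 * dot (r m.1) (fun k => x k - mirror_point z k).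

(** The transcript of the descent towards [x]. Once no row is violated it is filled up with [None],
    which keeps its length equal to [T]. The iterates can be recovered from [z] and the transcript
    alone. *)
Fixpoint moves (T : nat) z x : seq (option (I2 * bool)) :=
  if T is T'.+1 then
    let mv := [pick m | violated z x m] in
    mv :: (if mv is Some m then moves T' (fun k => z k + move_vec m k) x
           else nseq T' None)
  else [::].

Lemma size_moves T z x : size (moves T z x) = T.
Proof.
elim: T z => //= T IH z; case: pickP => [m _|_] /=; first by rewrite IH.
by rewrite size_nseq.
Qed.

(** With step length [u / 6] the violated row gains [u ^+ 2 / 6] to first order, while the
    smoothness error is [3 * (u / 6) ^+ 2 = u ^+ 2 / 12]. *)
Lemma gap_step z x m : violated z x m ->
  gap (fun k => z k + move_vec m k) x <= gap z x - u ^+ 2 / 12.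
Proof.
rewrite /violated => vm; case/andP: u01 => u0 u1.
have s2 : sgn m.2 ^+ 2 = 1 :> R by rewrite /sgn; case: (m.2); rewrite ?sqrrN expr1n.
have a01 : 0 <= u / 6 <= 6^-1 by lra.
have hb l : block_sq (move_vec m) l <= (u / 6) ^+ 2.
  have -> : block_sq (move_vec m) l = (u / 6) ^+ 2 * block_sq (r m.1) l.
    rewrite /block_sq mulr_sumr; apply: eq_bigr => k _.
    by rewrite /move_vec !exprMn s2 mul1r.
  by rewrite ler_piMr ?sqr_ge0.
have := ln_potential_step z l0 a01 hb.
have -> : dot (mirror_point z) (move_vec m) = (u / 6) *
   (sgn m.2 * dot (r m.1) (mirror_point z)).
  by rewrite /dot !mulr_sumr; apply: eq_bigr => k _; rewrite /move_vec; ring.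
have E : dot (fun k => z k + move_vec m k) x = dot z x + (u / 6) *
   (sgn m.2 * dot (r m.1) x).
  by rewrite /dot !mulr_sumr -big_split; apply: eq_bigr => k _; rewrite /move_vec /=; ring.
have D : dot (r m.1) (fun k => x k - mirror_point z k) =
  dot (r m.1) x - dot (r m.1) (mirror_point z).
  by rewrite /dot -sumrB; apply: eq_bigr => k _; ring.
rewrite /gap E => H; move: vm; rewrite D mulrBr.
set p := sgn _ * _; set q := sgn _ * dot _ _ => vm.
have : (u / 6) * u <= (u / 6) * (p - q) by rewrite ler_wpM2l //; lra.
by move: H; rewrite -/q; lra.
Qed.

(** The gap is too small for [T] moves, so both descents stop in time. Equal transcripts stop at the
    same mirror point, which is within [u] of [x] and of [x'] on every row. *)
Lemma moves_close T z x x' : sum_norm x <= 1 -> sum_norm x' <= 1 ->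
  gap z x < T%:R * (u ^+ 2 / 12) -> gap z x' < T%:R * (u ^+ 2 / 12) ->
  moves T z x = moves T z x' ->
  forall i, `|dot (r i) (fun k => x k - x' k)| <= 2 * u.
Proof.
move=> x1 x1'; elim: T z => [|T IH] z /=.
  by rewrite mul0r => g; have := gap_ge0 z l0 x1; rewrite leNgt g.
move=> g g'.
have inside y : violated z y =1 xpred0 ->
    forall i, `|dot (r i) (fun k => y k - mirror_point z k)| <= u.
  move=> h i; rewrite ler_norml; apply/andP; split.
    by have := h (i, false); rewrite /violated /sgn /=; set d := dot _ _; lra.
  by have := h (i, true); rewrite /violated /sgn /=; set d := dot _ _; lra.
case: pickP => [m vm|vx]; case: pickP => [m' vm'|vx'] //.
  case=> mm; rewrite -mm in vm' *; apply: IH.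
    have := gap_step vm; move: g; rewrite -natr1; lra.
  have := gap_step vm'; move: g'; rewrite -natr1; lra.
move=> _ i; have hx := inside _ vx i; have hx' := inside _ vx' i.
have -> : dot (r i) (fun k => x k - x' k) =
  dot (r i) (fun k => x k - mirror_point z k) - dot (r i) (fun k => x' k - mirror_point z k).
  by rewrite /dot -sumrB; apply: eq_bigr => k _; ring.
by apply: le_trans (ler_normB _ _) _; lra.
Qed.

End Covering.
End BlockNorms.

(** Each label class gets a representative that [pick] selects from the label only; the net thus
    consists of points of the family itself. *)
Lemma net_of_labels (T L : finType) (c : T -> L) :
  exists f : T -> T, (forall t, c (f t) = c t) /\ (#|f @: [set: T]| <= #|L|)%N.
Proof.
pose f t := odflt t [pick t' | c t' == c t].
have cf t : c (f t) = c t by rewrite /f; case: pickP => [t' /eqP|].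
exists f; split=> //.
have ff t t' : c t = c t' -> f t = f t'.
  by rewrite /f => ->; case: pickP => // /(_ t'); rewrite eqxx.
rewrite -(card_in_imset (f := c)); first exact: max_card.
by move=> _ _ /imsetP[t _ ->] /imsetP[t' _ ->]; rewrite !cf; exact: ff.
Qed.

(** The label is the transcript started at the origin, where the gap is [1 + ln #|B|]; each of its
    [N] entries is [None] or one of the [2 * #|I2|] signed rows. *)
Lemma mirror_descent_net (R : realType) (I B I2 T : finType) (blk : I -> B) (l0 : B)
    (r : I2 -> I -> R) (x : T -> I -> R) (u : R) (N : nat) :
  (forall i l, block_sq blk (r i) l <= 1) -> (forall t, sum_norm blk (x t) <= 1) ->
  0 < u <= 1 -> 12 * (1 + ln #|B|%:R) < N%:R * u ^+ 2 ->
  exists f : T -> T, (#|f @: [set: T]| <= (#|I2|.*2.+1) ^ N)%N /\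
    forall t i, `|dot (r i) (fun k => x t k - x (f t) k)| <= 2 * u.
Proof.
move=> r1 x1 u01 Nu.
pose c t : N.-tuple (option (I2 * bool)) :=
  Tuple (introT eqP (size_moves blk r u N (fun=> 0) (x t))).
have [f [cf fT]] := net_of_labels c; exists f; split.
  apply: leq_trans fT _; rewrite card_tuple card_option card_prod card_bool.
  by rewrite muln2.
move=> t i.
have B0 : 0 < #|B|%:R :> R by rewrite ltr0n; apply/card_gt0P; exists l0.
have g s : gap blk (fun=> 0) (x s) < N%:R * (u ^+ 2 / 12).
  by rewrite gap0 lnM ?posrE ?expR_gt0 // expRK; lra.
apply: (moves_close l0 r1 u01 (x1 _) (x1 _) (g t) (g (f t))).
by have /(congr1 val) := cf t => /= ->.
Qed.

(** * Chaining *)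

Lemma grid_net (R : realType) (I T : finType) (x : T -> I -> R) (H : nat) :
  (0 < H)%N -> (forall t k, `|x t k| <= 1) ->
  exists f : T -> T, (#|f @: [set: T]| <= (H.*2.+1) ^ #|I|)%N /\
    forall t k, `|x t k - x (f t) k| <= H%:R^-1.
Proof.
move=> H0 x1.
have H0' : 0 < H%:R :> R by rewrite ltr0n.
pose v t k := (x t k + 1) * H%:R.
have v0 t k : 0 <= v t k.
  by rewrite mulr_ge0 // -lerBlDr sub0r; have := x1 t k; rewrite ler_norml => /andP[].
have v2 t k : (Num.truncn (v t k) < H.*2.+1)%N.
  rewrite ltnS -(ler_nat R); apply: le_trans (_ : _ <= v t k) _.
    by have /andP[] := truncn_itv (v0 t k).
  rewrite /v -muln2 natrM mulrC ler_wpM2l //.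
  by have := x1 t k; rewrite ler_norml => /andP[]; lra.
pose c t : {ffun I -> 'I_(H.*2.+1)} := [ffun k => Ordinal (v2 t k)].
have [f [cf fT]] := net_of_labels c; exists f; split.
  by apply: leq_trans fT _; rewrite card_ffun card_ord.
move=> t k; have /ffunP /(_ k) := cf t; rewrite !ffunE => /(congr1 val) /= E.
have /andP[a1 a2] := truncn_itv (v0 t k); have /andP[b1 b2] := truncn_itv (v0 (f t) k).
rewrite E in b1 b2; rewrite -(ler_pM2r H0') mulVf ?gt_eqF // -[X in _ * X](gtr0_norm H0').
rewrite -normrM ler_norml; move: a1 a2 b1 b2; rewrite /v -natr1.
by set w := _%:R => *; apply/andP; split; lra.
Qed.

Section Chaining.
Context {R : realType} {I J B T : finType} (blk : I -> B) (l0 : B).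
Context (r : J -> bool -> I -> R) (x : T -> I -> R) (tau0 : T).
Hypothesis r1 : forall j c l, block_sq blk (r j c) l <= 1.
Hypothesis x1 : forall t, sum_norm blk (x t) <= 1.
Hypothesis x0 : forall k, x tau0 k = 0.

(** The two values of [c] carry the real and the imaginary part of a complex row, so this is a
    squared modulus. *)
Definition qform (y : I -> R) (j : J) : R := \sum_c dot (r j c) y ^+ 2.

Lemma qform_ge0 y j : 0 <= qform y j.
Proof. by apply: sumr_ge0 => c _; exact: sqr_ge0. Qed.

Lemma dotB (a y z : I -> R) : dot a (fun k => y k - z k) = dot a y - dot a z.
Proof. by rewrite /dot -sumrB; apply: eq_bigr => k _; rewrite mulrBr. Qed.

(** For complex numbers, the difference of squared moduli is at most [|z - w| |z + w|], and
    [|z + w|^2] is at most [2 (|z|^2 + |w|^2)]; the deficit is an explicit sum of two squares. *)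
Lemma qform_sub_sqr y z j : (qform y j - qform z j) ^+ 2 <=
  qform (fun k => y k - z k) j * (2 * (qform y j + qform z j)).
Proof.
rewrite /qform !big_bool /= !dotB.
set a := dot _ y; set b := dot _ z; set c := dot _ y; set d := dot _ z.
rewrite -subr_ge0.
suff -> : ((a - b) ^+ 2 + (c - d) ^+ 2) * (2 * (a ^+ 2 + c ^+ 2 + (b ^+ 2 + d ^+ 2))) -
   (a ^+ 2 + c ^+ 2 - (b ^+ 2 + d ^+ 2)) ^+ 2 =
   ((a - b) ^+ 2 + (c - d) ^+ 2) ^+ 2 + ((a - b) * (c + d) - (c - d) * (a + b)) ^+ 2.
  by rewrite addr_ge0 ?sqr_ge0.
ring.
Qed.

Section FixedCoefficients.
Context (t : J -> R) (s2 : R).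
Hypothesis t1 : forall j, `|t j| <= 1.
Hypothesis ts : forall tau, \sum_j `|t j| * qform (x tau) j <= s2.

Lemma scale_ge0 : 0 <= s2.
Proof.
by apply: le_trans (ts tau0); apply: sumr_ge0 => j _; rewrite mulr_ge0 ?qform_ge0.
Qed.

(** The variance of an increment is controlled by the form itself: the first factor in
    [qform_sub_sqr] is at most [D], the second one sums to at most [4 * s2] against [|t j|], and
    [t j ^+ 2 <= |t j|]. *)
Lemma increment_variance (D : R) (a b : T) : 0 <= D ->
  (forall j, qform (fun k => x a k - x b k) j <= D) ->
  \sum_j (t j * (qform (x a) j - qform (x b) j)) ^+ 2 <= 4 * D * s2.
Proof.
move=> D0 hD.
apply: (@le_trans _ _ (\sum_j 2 * D * (`|t j| * qform (x a) j + `|t j| * qform (x b) j))).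
  apply: ler_sum => j _; rewrite exprMn -(real_normK (num_real (t j))).
  apply: (@le_trans _ _ (`|t j| * (D * (2 * (qform (x a) j + qform (x b) j))))).
    apply: ler_pM; rewrite ?sqr_ge0 //; first by rewrite expr2 ler_piMr.
    apply: le_trans (qform_sub_sqr _ _ _) _; apply: ler_wpM2r => //.
    by rewrite mulr_ge0 // addr_ge0 ?qform_ge0.
  by apply/eq_leW; ring.
rewrite -mulr_sumr big_split /=.
have -> : 4 * D * s2 = 2 * D * (s2 + s2) by ring.
by rewrite ler_wpM2l ?mulr_ge0 // lerD.
Qed.

(** * Nets at dyadic scales and the chain through them *)

Section Nets.
Context (K nu T0 : nat).
Hypothesis J0 : (0 < #|J|)%N.
Hypothesis nuP : (4 * #|J| + 1 <= 2 ^ nu)%N.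
Hypothesis KP : (#|I| <= 2 ^ K <= 2 * #|I|)%N.
Hypothesis T0P : 12 * (1 + ln #|B|%:R) < T0%:R :> R.

Let close (f : T -> T) (D : R) :=
  forall tau j c, `|dot (r j c) (fun k => x tau k - x (f tau) k)| <= D.

Let B1 : 0 <= ln #|B|%:R :> R.
Proof. by apply: ln_ge0; rewrite ler1n; apply/card_gt0P; exists l0. Qed.

Let T0_gt0 : (0 < T0)%N.
Proof. rewrite -(ltr0n R); move: T0P B1; lra. Qed.

Let nu_gt0 : (0 < nu)%N.
Proof. rewrite lt0n; apply/negP => /eqP nu0; move: J0 nuP; rewrite nu0 expn0; lia. Qed.

Let I0 : (0 < #|I|)%N.
Proof. by have := expn_gt0 2 K; move: KP; lia. Qed.

(** At scale [2 ^- l] the descent needs [T0 * 4 ^ l] moves, and a transcript entry takes at most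
    [2 ^ nu] values because there are [2 * #|J|] real rows. *)
Lemma mirror_level l : exists f : T -> T,
  (#|f @: [set: T]| <= 2 ^ (nu * T0 * 4 ^ l))%N /\ close f (2 * 2 ^- l).
Proof.
have u01 : 0 < (2 ^- l : R) <= 1.
  by rewrite invr_gt0 exprn_gt0 // invf_le1 ?exprn_gt0 // exprn_ege1 // ler1n.
have Nu : 12 * (1 + ln #|B|%:R) < (T0 * 4 ^ l)%:R * (2 ^- l) ^+ 2 :> R.
  rewrite natrM natrX exprVn -exprM mulnC exprM (_ : 2 ^+ 2 = 4) -?mulrA; last by ring.
  by rewrite mulfV ?mulr1 // expf_neq0 // pnatr_eq0.
have r1' (i : J * bool) l' : block_sq blk (r i.1 i.2) l' <= 1 by [].
have [f [fc fd]] := mirror_descent_net l0 r1' x1 u01 Nu.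
exists f; split; last by move=> tau j c; exact: (fd tau (j, c)).
apply: leq_trans fc _; rewrite -mulnA [in leqRHS]expnM leq_exp2r; last first.
  by rewrite muln_gt0 T0_gt0 expn_gt0.
by apply: leq_trans nuP; rewrite card_prod card_bool -!muln2; lia.
Qed.

(** The mesh [1 / H] with [H = 2 d^2 n] makes the error on every row at most [1 / (2 d n)], which is
    below both the dyadic scale and the square root of [1 / n]. As [2 ^ K] is of the order of [d],
    the size of the grid still fits the growth [4 ^ l] of the exponents. *)
Lemma grid_level : exists f : T -> T,
  [/\ (#|f @: [set: T]| <= 2 ^ (3 * nu * 4 ^ K))%N,
      close f (2 * 2 ^- K.+1) &
      forall tau j c, dot (r j c) (fun k => x tau k - x (f tau) k) ^+ 2 <= #|J|%:R^-1].
Proof.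
pose d := #|I|; pose n := #|J|; pose H := (2 * d ^ 2 * n)%N.
have dN : (0 < d)%N := I0; have nN : (0 < n)%N := J0.
have H0 : (0 < H)%N by rewrite /H !muln_gt0 ?expn_gt0 ?dN ?nN.
have x1' tau k : `|x tau k| <= 1.
  apply: le_trans (x1 tau); rewrite /sum_norm (bigD1 (blk k)) //= -[leLHS]addr0.
  apply: lerD; last by apply: sumr_ge0 => l _; exact: sqrtr_ge0.
  rewrite -sqrtr_sqr ler_wsqrtr // /block_sq (bigD1 k) //= lerDl.
  by apply: sumr_ge0 => k' _; exact: sqr_ge0.
have [f [fc fd]] := grid_net H0 x1'.
have d0 : 0 < d%:R :> R by rewrite ltr0n.
have n1 : 1 <= n%:R :> R by rewrite ler1n.
have d1 : 1 <= d%:R :> R by rewrite ler1n.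
have fd' tau j c : `|dot (r j c) (fun k => x tau k - x (f tau) k)| <= (2 * d%:R * n%:R)^-1.
  apply: le_trans (_ : _ <= \sum_(k : I) H%:R^-1) _.
    apply: le_trans (ler_norm_sum _ _ _) _; apply: ler_sum => k _; rewrite normrM.
    rewrite -[leRHS]mul1r; apply: ler_pM => //.
    have r2 : r j c k ^+ 2 <= 1.
      apply: le_trans (r1 j c (blk k)); rewrite /block_sq (bigD1 k) //= lerDl.
      by apply: sumr_ge0 => k' _; exact: sqr_ge0.
    by rewrite -(expr_le1 (n := 2)) // real_normK ?num_real.
  rewrite sumr_const -[leLHS]mulr_natl -/d /H !natrM.
  apply/eq_leW; field; apply/andP; split; rewrite gt_eqF //; lra.
have dn1 : 1 <= d%:R * n%:R :> R by rewrite mulr_ege1.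
exists f; split.
- apply: leq_trans fc _.
  have -> : (3 * nu * 4 ^ K = (3 * nu) * (2 ^ K * 2 ^ K))%N.
    by rewrite -expnMn.
  have h : (H.*2.+1 <= 2 ^ (nu + 2 * K))%N.
    rewrite expnD mulnC; apply: leq_trans (_ : _ <= d ^ 2 * (4 * n + 1))%N _.
      rewrite /H -muln2; have : (0 < d ^ 2)%N by rewrite expn_gt0 dN.
      by move: (d ^ 2)%N => D; nia.
    apply: leq_mul => //; rewrite mulnC expnM leq_exp2r //.
    by move: KP; rewrite -/d => /andP[].
  apply: (@leq_trans ((2 ^ (nu + 2 * K)) ^ #|I|)); first by rewrite leq_exp2r.
  rewrite -expnM leq_exp2l // -/d.
  have KK : (K < 2 ^ K)%N by rewrite ltn_expl.
  have dK : (d <= 2 ^ K)%N by move: KP; rewrite -/d => /andP[].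
  apply: leq_trans (leq_mul (leqnn _) dK) _.
  rewrite [leqRHS]mulnA leq_mul2r; apply/orP; right.
  by move: (2 ^ K)%N KK nu_gt0 => P; nia.
- move=> tau j c; apply: le_trans (fd' tau j c) _.
  have -> : 2 * 2 ^- K.+1 = 2 ^- K :> R.
    by rewrite exprS invfM mulrA mulfV ?mul1r // pnatr_eq0.
  rewrite lef_pV2 ?posrE ?exprn_gt0 //; last by lra.
  apply: (@le_trans _ _ (2 * d%:R)); last by rewrite ler_peMr ?mulr_ge0.
  by rewrite -natrX -natrM ler_nat; move: KP; rewrite -/d => /andP[].
move=> tau j c; rewrite -(real_normK (num_real _)).
apply: (@le_trans _ _ ((2 * d%:R * n%:R)^-1 ^+ 2)).
  by apply: lerXn2r; rewrite ?nnegrE // invr_ge0; lra.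
rewrite -/n exprVn lef_pV2 ?posrE ?exprn_gt0 //; [|lra|lra].
apply: (@le_trans _ _ (1 * n%:R)); first by rewrite mul1r.
have -> : (2 * d%:R * n%:R) ^+ 2 = (4 * d%:R * (d%:R * n%:R)) * n%:R :> R by ring.
rewrite ler_wpM2r //; last by nra.
Qed.

(** Level 0 is the zero point, levels 1 to [K] are mirror nets, level [K.+1] is the grid and level
    [K.+2] the identity. Links count pairs of points, whence the factor 5 = 1 + 4: [4 ^ l.+1] is
    four times [4 ^ l], and the grid needs no more than that. *)
Lemma net_sequence : exists g : nat -> T -> T,
  [/\ forall tau, g 0 tau = tau0,
      forall tau, g K.+2 tau = tau,
      forall l, close (g l) (2 * 2 ^- l),
      forall l, (l <= K)%N ->
        (#|g l @: [set: T]| * #|g l.+1 @: [set: T]| <= 2 ^ (5 * nu * T0 * 4 ^ l))%N &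
      forall tau j c,
        dot (r j c) (fun k => x tau k - x (g K.+1 tau) k) ^+ 2 <= #|J|%:R^-1].
Proof.
have [m mP] := choice mirror_level.
have [f [fc fd fn]] := grid_level.
pose g l := if l is 0 then (fun=> tau0) else
  if (l <= K)%N then m l else if l == K.+1 then f else id.
have gle l : (0 < l)%N -> (l <= K)%N -> g l = m l by case: l => // l _ /= ->.
have gK : g K.+1 = f by rewrite /g ltnn eqxx.
have gc l : (l <= K)%N -> (#|g l @: [set: T]| <= 2 ^ (nu * T0 * 4 ^ l))%N.
  case: l => [_|l lK]; last by rewrite gle //; case: (mP l.+1).
  apply: (@leq_trans 1); last by rewrite expn_gt0.
  rewrite -(cards1 tau0); apply/subset_leq_card/fintype.subsetP => _ /imsetP[t' _ ->].
  by rewrite inE.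
exists g; split.
- by [].
- by move=> tau; rewrite /g ltnNge leqnSn /= gtn_eqF.
- case=> [|l] tau j c.
    rewrite /g expr0 invr1 mulr1.
    have -> : dot (r j c) (fun k => x tau k - x tau0 k) = dot (r j c) (x tau).
      by apply: eq_bigr => k _; rewrite x0 subr0.
    apply: le_trans (normr_dot_le (blk := blk) (c := 1) _ ler01 _) _ => [l|].
      by rewrite expr1n.
    by rewrite mul1r; apply: le_trans (x1 tau) _; rewrite ler1n.
  rewrite /g; case: (leqP l.+1 K) => lK; first by have [_] := mP l.+1; apply.
  case: eqP => [->|_]; first exact: fd.
  have -> : dot (r j c) (fun k => x tau k - x (id tau) k) = 0.
    by rewrite /dot big1 // => k _; rewrite subrr mulr0.
  by rewrite normr0 mulr_ge0 // invr_ge0 exprn_ge0.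
- move=> l lK; have gl := gc _ lK.
  have gl1 : (#|g l.+1 @: [set: T]| <= 2 ^ (4 * nu * T0 * 4 ^ l))%N.
    case: (leqP l.+1 K) => lK1.
      by apply: leq_trans (gc _ lK1) _; rewrite leq_exp2l // expnS; lia.
    have -> : l = K by apply/eqP; rewrite eqn_leq lK -ltnS.
    rewrite gK; apply: leq_trans fc _; rewrite leq_exp2l // leq_mul2r.
    by apply/orP; right; move: T0_gt0; nia.
  apply: leq_trans (leq_mul gl gl1) _; rewrite -expnD leq_exp2l //; lia.
by rewrite gK.
Qed.

(** The square of [K + 2] pays for splitting into [K + 2] links; 576 = 8 * 72, with 72 the variance
    constant of a link and 8 the constant of [rademacher_sup_moment]. *)
Definition chain_factor (q : nat) : R :=
  (K + 2)%:R ^+ 2 * (576 * (5 * nu * T0 + q)%:R).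

(** The logarithm of the number of pairs grows like [4 ^ l] while the squared increments decay like
    [4 ^- l], so the same bound holds at every scale. *)
Lemma chain_link (g : nat -> T -> T) (l q : nat) (xi : {ffun J -> bool} -> T) :
  (0 < q)%N -> (l <= K)%N -> (forall l, close (g l) (2 * 2 ^- l)) ->
  (#|g l @: [set: T]| * #|g l.+1 @: [set: T]| <= 2 ^ (5 * nu * T0 * 4 ^ l))%N ->
  Ex 2^-1 (fun e => rsum (fun j =>
     t j * (qform (x (g l.+1 (xi e))) j - qform (x (g l (xi e))) j)) e ^+ (2 * q)) <=
  (576 * (5 * nu * T0 + q)%:R * s2) ^+ q.
Proof.
move=> q0 lK gcl gcount; have s20 := scale_ge0.
pose A := [set (g l tau, g l.+1 tau) | tau in [set: T]].
pose gg (k : T * T) j := t j * (qform (x k.2) j - qform (x k.1) j).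
(* The extra power [rr] makes [q * rr] exceed the entropy [a] by at most [q]. *)
pose a := (5 * nu * T0 * 4 ^ l)%N; pose rr := (a %/ q).+1.
have ql : 0 <= (4 ^- l : R) by rewrite invr_ge0 exprn_ge0.
have four : (2 ^- l) ^+ 2 = 4 ^- l :> R.
  by rewrite exprVn -exprM mulnC exprM (_ : 2 ^+ 2 = 4) //; ring.
have var k : k \in A -> \sum_j gg k j ^+ 2 <= 72 * 4 ^- l * s2.
  case/imsetP => tau _ ->; rewrite /gg /=.
  have -> : 72 * 4 ^- l * s2 = 4 * (18 * 4 ^- l) * s2 :> R by ring.
  apply: increment_variance; first by rewrite mulr_ge0.
  move=> j; rewrite /qform big_bool /=.
  suff h c : dot (r j c) (fun k => x (g l.+1 tau) k - x (g l tau) k) ^+ 2 <= 9 * 4 ^- l.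
    by apply: le_trans (lerD (h true) (h false)) _; lra.
  (* The errors [2 * 2 ^- l] and [2 ^- l] of the two levels add up to [3 * 2 ^- l]. *)
  rewrite -(real_normK (num_real _)) (_ : 9 * 4 ^- l = (3 * 2 ^- l) ^+ 2); last first.
    by rewrite exprMn four; ring.
  have p0 : 0 <= (2 ^- l : R) by rewrite invr_ge0 exprn_ge0.
  apply: lerXn2r; rewrite ?nnegrE ?mulr_ge0 //.
  have := gcl l tau j c; have := gcl l.+1 tau j c; rewrite !dotB exprS invfM.
  rewrite !ler_norml => /andP[h1 h2] /andP[h3 h4]; apply/andP; split; lra.
have cA : (#|A| <= 2 ^ (q * rr))%N.
  apply: leq_trans (_ : _ <= 2 ^ a)%N _; last first.
    rewrite leq_exp2l // /rr mulnS; have := divn_eq a q; have := ltn_pmod a q0; lia.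
  apply: leq_trans gcount; rewrite -cardsX; apply/subset_leq_card/fintype.subsetP.
  by move=> _ /imsetP[tau _ ->]; rewrite inE /= !imset_f ?inE.
have sv0 : 0 <= 72 * 4 ^- l * s2 by rewrite mulr_ge0 // mulr_ge0.
have lA e : (g l (xi e), g l.+1 (xi e)) \in A by apply: imset_f; rewrite inE.
have := rademacher_sup_moment (g := gg) (ltn0Sn _ : (0 < rr)%N) sv0 lA var cA.
move=> /le_trans; apply.
have -> : 8 * (q * rr)%:R * (72 * 4 ^- l * s2) = 576 * ((q * rr)%:R * 4 ^- l) * s2 :> R.
  by ring.
have c0 : 0 <= 576 :> R by exact: ler0n.
move: (576 : R) c0 => c c0.
apply: lerXn2r; rewrite ?nnegrE ?mulr_ge0 //.
rewrite ler_wpM2r // ler_wpM2l //.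
apply: (@le_trans _ _ ((5 * nu * T0 * 4 ^ l + q * 4 ^ l)%:R * 4 ^- l)).
  rewrite ler_wpM2r // ler_nat /rr mulnS.
  have := leq_trunc_div a q; have : (0 < 4 ^ l)%N by rewrite expn_gt0.
  by rewrite /a; move: (4 ^ l)%N => P; nia.
rewrite -mulnDl natrM natrX mulfK // expf_neq0 // pnatr_eq0.
Qed.

(** Since [xi] may depend on the signs, this bounds a supremum over the family. The form is
    telescoped along the nets, and the power mean inequality recombines the links. *)
Theorem chaining_moment (q : nat) (xi : {ffun J -> bool} -> T) : (0 < q)%N ->
  Ex 2^-1 (fun e => rsum (fun j => t j * qform (x (xi e)) j) e ^+ (2 * q)) <=
  (chain_factor q * s2) ^+ q.
Proof.
move=> q0; have [g [g0 gend gcl gcount gfine]] := net_sequence.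
have s20 := scale_ge0.
pose Y i e := rsum (fun j =>
     t j * (qform (x (g i.+1 (xi e))) j - qform (x (g i (xi e))) j)) e.
have tele e : rsum (fun j => t j * qform (x (xi e)) j) e = \sum_(i < K.+2) Y i e.
  rewrite /Y /rsum exchange_big; apply: eq_bigr => j _ /=.
  rewrite -mulr_sumr -mulr_sumr; congr (_ * (_ * _)).
  rewrite -(big_mkord predT (fun i => qform (x (g i.+1 (xi e))) j - qform (x (g i (xi e))) j)).
  rewrite telescope_sumr // gend g0 [X in _ = _ - X](_ : _ = 0) ?subr0 //.
  rewrite /qform big1 // => c _; rewrite /dot big1 ?expr0n // => k _.
  by rewrite x0 mulr0.
pose C : R := 576 * (5 * nu * T0 + q)%:R * s2.
have C0 : 0 <= C := mulr_ge0 (mulr_ge0 (ler0n _ _) (ler0n _ _)) s20.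
have half01 : 0 <= (2^-1 : R) <= 1 by lra.
have Yle (i : 'I_K.+2) : Ex 2^-1 (fun e => Y i e ^+ (2 * q)) <= C ^+ q.
  case: (leqP i K) => iK; first by apply: chain_link => //; exact: gcount.
  have {iK} -> : nat_of_ord i = K.+1.
    by apply/eqP; rewrite eqn_leq iK -ltnS ltn_ord.
  (* The last link, from the grid to the point itself, is bounded for every sign pattern: the factor
     [#|J|] from Cauchy-Schwarz is cancelled by the accuracy [#|J|^-1] of the grid. *)
  rewrite -[leRHS](@Ex_cst _ J 2^-1); apply: Ex_le => // e; rewrite exprM.
  apply: lerXn2r; rewrite ?nnegrE ?sqr_ge0 //.
  apply: le_trans (sqr_sum_le _) _.
  have -> : \sum_j (sgn (e j) * (t j * (qform (x (g K.+2 (xi e))) j -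
       qform (x (g K.+1 (xi e))) j))) ^+ 2 =
     \sum_j (t j * (qform (x (xi e)) j - qform (x (g K.+1 (xi e))) j)) ^+ 2.
    apply: eq_bigr => j _; rewrite gend exprMn (_ : sgn _ ^+ 2 = 1) ?mul1r //.
    by rewrite /sgn; case: (e j); rewrite ?sqrrN expr1n.
  have Jn0 : #|J|%:R != 0 :> R by rewrite pnatr_eq0 -lt0n.
  have hD j : qform (fun k => x (xi e) k - x (g K.+1 (xi e)) k) j <= 2 * #|J|%:R^-1.
    by rewrite /qform big_bool /=; have := gfine (xi e) j true; have := gfine (xi e) j false; lra.
  have D0 : 0 <= 2 * #|J|%:R^-1 :> R by rewrite mulr_ge0 // invr_ge0.
  apply: le_trans (ler_wpM2l (ler0n _ _) (increment_variance D0 hD)) _.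
  have -> : #|J|%:R * (4 * (2 * #|J|%:R^-1) * s2) = 8 * s2 by field.
  have N1 : 1 <= (5 * nu * T0 + q)%:R :> R by rewrite ler1n; lia.
  by rewrite /C; apply: ler_wpM2r => //; lra.
rewrite (eq_Ex _ (g := fun e => (\sum_(i < K.+2) Y i e) ^+ (2 * q))); last first.
  by move=> e; rewrite tele.
case: q q0 @C C0 Yle => // q _ C C0 Yle.
apply: (@le_trans _ _ (Ex 2^-1 (fun e => K.+2%:R ^+ (2 * q).+1 *
    \sum_(i < K.+2) Y i e ^+ (2 * q.+1)))).
  by apply: Ex_le => // e; exact: sum_ord_pow_le.
rewrite ExZ Ex_sum.
apply: (@le_trans _ _ (K.+2%:R ^+ (2 * q).+1 * \sum_(i < K.+2) C ^+ q.+1)).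
  by rewrite ler_wpM2l ?exprn_ge0 // ler_sum.
rewrite sumr_const card_ord -[X in _ * X]mulr_natl mulrA -exprSr.
rewrite (_ : (2 * q).+2 = 2 * q.+1)%N; last by rewrite mulnS.
rewrite exprM -exprMn /chain_factor addn2; apply/eq_leW; congr (_ ^+ _).
by rewrite /C -!mulrA.
Qed.

End Nets.
End FixedCoefficients.
End Chaining.

(** * Symmetrization of the selectors *)

Section MoreExpectation.
Context {R : realFieldType} {J : finType}.
Implicit Types (f g : {ffun J -> bool} -> R) (F : {ffun J -> bool} -> {ffun J -> bool} -> R).

Lemma Ex_exchange (p p' : R) F :
  Ex p (fun t => Ex p' (F t)) = Ex p' (fun e => Ex p (F^~ e)).
Proof.
rewrite /Ex; under eq_bigr do rewrite mulr_sumr.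
rewrite exchange_big; apply: eq_bigr => e _; rewrite mulr_sumr.
by apply: eq_bigr => t _; rewrite mulrCA.
Qed.

(** Jensen's inequality for signed functions: nonnegativity of the variance handles the square,
    [Ex_pow_le] the remaining power. *)
Lemma Ex_even_pow_le (p : R) f q : 0 <= p <= 1 ->
  (Ex p f) ^+ (2 * q) <= Ex p (fun t => f t ^+ (2 * q)).
Proof.
move=> hp; have sq : (Ex p f) ^+ 2 <= Ex p (fun t => f t ^+ 2).
  have : 0 <= Ex p (fun t => (f t - Ex p f) ^+ 2) by apply: Ex_ge0 => // t; exact: sqr_ge0.
  rewrite (eq_Ex p (g := fun t => f t ^+ 2 + (- 2 * Ex p f * f t + Ex p f ^+ 2))).
    by rewrite !ExD ExZ Ex_cst; lra.
  by move=> t; ring.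
rewrite exprM; apply: (@le_trans _ _ ((Ex p (fun t => f t ^+ 2)) ^+ q)).
  by apply: lerXn2r; rewrite ?nnegrE ?sqr_ge0 // Ex_ge0 // => t; exact: sqr_ge0.
apply: le_trans (Ex_pow_le _ hp _) _ => [t|]; first exact: sqr_ge0.
by apply: Ex_le => // t; rewrite exprM.
Qed.

Definition mix (e a b : {ffun J -> bool}) : {ffun J -> bool} :=
  [ffun j => if e j then a j else b j].

(** Exchanging the coordinates of two independent copies wherever [e] is false preserves their joint
    law. *)
Lemma Ex_mix (p : R) F (e : {ffun J -> bool}) :
  Ex p (fun a => Ex p (F a)) = Ex p (fun a => Ex p (fun b => F (mix e a b) (mix e b a))).
Proof.
pose h (k : {ffun J -> bool} * {ffun J -> bool}) := (mix e k.1 k.2, mix e k.2 k.1).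
have hK : involutive h.
  by case=> a b; congr (_, _); apply/ffunP => j; rewrite !ffunE; case: (e j).
have E G : Ex p (fun a => Ex p (G a)) = \sum_k bern p k.1 * bern p k.2 * G k.1 k.2.
  rewrite -(pair_bigA _ (fun a b => bern p a * bern p b * G a b)) /=.
  by apply: eq_bigr => a _; rewrite mulr_sumr; apply: eq_bigr => b _; rewrite mulrA.
rewrite !E (reindex_inj (inv_inj hK)) /=; apply: eq_bigr => -[a b] _ /=.
congr (_ * _); rewrite /bern -!big_split; apply: eq_bigr => j _ /=; rewrite !ffunE.
by case: (e j) => //; rewrite mulrC.
Qed.

End MoreExpectation.

Lemma add3_pow_le (R : realDomainType) (a b c : R) q : 0 <= a -> 0 <= b -> 0 <= c ->
  (a + b + c) ^+ q <= 3 ^+ q * (a ^+ q + b ^+ q + c ^+ q).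
Proof.
move=> a0 b0 c0.
have [aq bq cq] : [/\ 0 <= a ^+ q, 0 <= b ^+ q & 0 <= c ^+ q] by rewrite !exprn_ge0.
have key m : 0 <= m -> a <= m -> b <= m -> c <= m ->
    m ^+ q <= a ^+ q + b ^+ q + c ^+ q ->
    (a + b + c) ^+ q <= 3 ^+ q * (a ^+ q + b ^+ q + c ^+ q).
  move=> m0 am bm cm mq.
  apply: (@le_trans _ _ ((3 * m) ^+ q)).
    by apply: lerXn2r; rewrite ?nnegrE ?addr_ge0 ?mulr_ge0 //; lra.
  by rewrite exprMn ler_wpM2l ?exprn_ge0.
case: (leP a b) => ab; case: (leP b c) => bc; case: (leP a c) => ac.
all: try (apply: (key a); by [|lra]); try (apply: (key b); by [|lra]).
all: apply: (key c); by [|lra].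
Qed.

(** * Moments of the largest selector deviation *)

Section Selectors.
Context {R : realFieldType} {J T : finType} (Q : T -> J -> R) (tau0 : T).
Context (p Gam mu : R) (q : nat).
Hypothesis Q0 : forall tau j, 0 <= Q tau j.
Hypothesis p01 : 0 <= p <= 1.
Hypothesis Gam0 : 0 <= Gam.
Hypothesis Gmu : Gam <= mu.
Hypothesis meanQ : forall tau, p * \sum_j Q tau j <= 4 * mu.
Hypothesis chain : forall (t : J -> R) (s2 : R) (xi : {ffun J -> bool} -> T),
  (forall j, `|t j| <= 1) -> (forall tau, \sum_j `|t j| * Q tau j <= s2) ->
  Ex 2^-1 (fun e => rsum (fun j => t j * Q (xi e) j) e ^+ (2 * q)) <= (Gam * s2) ^+ q.

Definition selector_dev (th : {ffun J -> bool}) (tau : T) : R :=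
  \sum_j ((th j)%:R - p) * Q tau j.

(** The maximizer itself is kept, because after symmetrization it becomes the sign-dependent point
    of the chaining bound. *)
Definition worst th : T := [arg max_(tau > tau0) `|selector_dev th tau|]%O.

Definition max_dev th : R := `|selector_dev th (worst th)|.

Lemma selector_dev_le th tau : `|selector_dev th tau| <= max_dev th.
Proof. by rewrite /max_dev /worst; case: arg_maxP => // w _; exact. Qed.

Let diff (a b : {ffun J -> bool}) j : R := (a j)%:R - (b j)%:R.

Lemma diff_le1 a b j : `|diff a b j| <= 1.
Proof.
by rewrite /diff; case: (a j); case: (b j) => /=;
  rewrite ?subrr ?subr0 ?sub0r ?normrN ?normr0 ?normr1.
Qed.

Lemma decouple th tau : selector_dev th tau = Ex p (fun b => \sum_j diff th b j * Q tau j).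
Proof.
rewrite Ex_sum; apply: eq_bigr => j _.
rewrite (eq_Ex p (g := fun t => (th j)%:R * Q tau j + - Q tau j * (t j)%:R)).
  by rewrite ExD Ex_cst ExZ Ex_bit; ring.
by move=> t; rewrite /diff; ring.
Qed.

(** Self-bounding: as [|a j - b j| <= a j + b j], the scale that chaining asks for is again
    expressed by the two deviations and the mean. *)
Lemma diff_scale a b tau :
  \sum_j `|diff a b j| * Q tau j <= max_dev a + max_dev b + 8 * mu.
Proof.
have h (th : {ffun J -> bool}) : \sum_j (th j)%:R * Q tau j <= max_dev th + 4 * mu.
  apply: (@le_trans _ _ (selector_dev th tau + p * \sum_j Q tau j)).
    rewrite /selector_dev mulr_sumr -big_split; apply: ler_sum => j _ /=.
    by apply: eq_leW; ring.
  by apply: lerD => //; apply: le_trans (ler_norm _) (selector_dev_le _ _).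
apply: (@le_trans _ _ (\sum_j (a j)%:R * Q tau j + \sum_j (b j)%:R * Q tau j)).
  rewrite -big_split; apply: ler_sum => j _ /=; rewrite -mulrDl ler_wpM2r //.
  by apply: le_trans (ler_normB _ _) _; rewrite !normr_nat.
by apply: le_trans (lerD (h a) (h b)) _; apply: eq_leW; ring.
Qed.

(** Jensen's inequality in the copy [b], with the maximizer for [a] held fixed, decouples the
    deviation. Exchanging coordinates according to [e] multiplies each difference by [sgn (e j)],
    and the chaining bound applies for fixed [a] and [b]. *)
Lemma max_dev_symmetrize : Ex p (fun th => max_dev th ^+ (2 * q)) <=
  Ex p (fun a => Ex p (fun b => (Gam * (max_dev a + max_dev b + 8 * mu)) ^+ q)).
Proof.
have even (u : R) : `|u| ^+ (2 * q) = u ^+ (2 * q).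
  by rewrite !exprM real_normK ?num_real.
pose F a b : R := (\sum_j diff a b j * Q (worst a) j) ^+ (2 * q).
apply: (@le_trans _ _ (Ex p (fun a => Ex p (F a)))).
  apply: Ex_le => // a; rewrite /max_dev even decouple; exact: Ex_even_pow_le.
have half01 : 0 <= (2^-1 : R) <= 1 by lra.
rewrite -[leLHS](@Ex_cst _ J 2^-1) (eq_Ex _ (fun e => Ex_mix p F e)).
rewrite Ex_exchange; apply: Ex_le => // a; rewrite Ex_exchange; apply: Ex_le => // b.
apply: le_trans (chain (fun e => worst (mix e a b)) (diff_le1 a b) (diff_scale a b)).
apply: Ex_le => // e; apply: eq_leW; congr (_ ^+ _); apply: eq_bigr => j _.
by rewrite mulrA /diff !ffunE /sgn; case: (e j); ring.
Qed.

Let max_dev_ge0 th : 0 <= max_dev th.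
Proof. exact: normr_ge0. Qed.

(** The symmetrized bound involves only [q]-th powers of the deviation, so
    [2 u v <= u^2 / 2 + 2 v^2] absorbs half of the [2q]-th moment on the left; [Gam <= mu] merges
    the remaining terms. *)
Lemma max_dev_moment : Ex p (fun th => max_dev th ^+ (2 * q)) <= 6 * (24 * Gam * mu) ^+ q.
Proof.
have mu0 : 0 <= mu by apply: le_trans Gmu.
set X := Ex _ _.
pose Y := Ex p (fun th => (3 * Gam) ^+ q * max_dev th ^+ q).
have c24 : 24 * Gam * mu = 3 * Gam * (8 * mu) by ring.
have h1 : X <= Y + Y + (24 * Gam * mu) ^+ q.
  apply: le_trans max_dev_symmetrize _.
  apply: (@le_trans _ _ (Ex p (fun a => Ex p (fun b => (3 * Gam) ^+ q * max_dev a ^+ q +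
     (3 * Gam) ^+ q * max_dev b ^+ q + (24 * Gam * mu) ^+ q)))).
    apply: Ex_le => // a; apply: Ex_le => // b.
    rewrite c24 [(3 * Gam * _) ^+ _]exprMn -!mulrDr [in leLHS]exprMn (exprMn _ 3).
    rewrite -mulrA mulrCA ler_wpM2l ?exprn_ge0 //.
    by apply: add3_pow_le; rewrite ?mulr_ge0.
  apply: eq_leW; rewrite (eq_Ex p (g := fun a => (3 * Gam) ^+ q * max_dev a ^+ q +
      (Y + (24 * Gam * mu) ^+ q))) ?ExD ?Ex_cst ?addrA //.
  by move=> a; rewrite !ExD !Ex_cst addrA.
have h2 : Y + Y <= 2^-1 * X + 2 * ((3 * Gam) ^+ q) ^+ 2.
  rewrite -ExD -ExZ -[2 * _](@Ex_cst _ J p) -ExD; apply: Ex_le => // th.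
  rewrite (mulnC 2) exprM; set u := max_dev th ^+ q; set v := _ ^+ q.
  by have := sqr_ge0 (u - 2 * v); lra.
have h3 : ((3 * Gam) ^+ q) ^+ 2 <= (24 * Gam * mu) ^+ q.
  rewrite -exprM mulnC exprM; apply: lerXn2r; rewrite ?nnegrE ?sqr_ge0 ?mulr_ge0 //.
  have : Gam * Gam <= Gam * mu by rewrite ler_wpM2l.
  have : 0 <= Gam * mu by rewrite mulr_ge0.
  by rewrite expr2; lra.
by move: h1 h2 h3; lra.
Qed.

(** Markov's inequality for the [2q]-th moment; 96 = 4 * 24 makes the ratio of the bases at most
    1/4. *)
Lemma selector_tail (eps : R) : 0 < eps -> 0 < mu -> 96 * Gam <= eps ^+ 2 * mu ->
  \sum_(th | [exists tau, eps * mu < `|selector_dev th tau|]) bern p th <= 6 * 4^-1 ^+ q.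
Proof.
move=> eps0 mu0 hG.
have em0 : 0 < eps * mu by rewrite mulr_gt0.
have c0 : 0 < (eps * mu) ^+ (2 * q) by rewrite exprn_gt0.
apply: le_trans (markov (f := fun th => max_dev th ^+ (2 * q)) p01 c0 _ _) _.
- by move=> t; rewrite exprn_ge0.
- move=> th /existsP[tau ht]; apply: lerXn2r; rewrite ?nnegrE ?(ltW em0) //.
  by apply: le_trans (ltW ht) (selector_dev_le _ _).
rewrite ler_pdivrMr //; apply: le_trans max_dev_moment _.
rewrite -[leRHS]mulrA ler_wpM2l // exprM -exprMn; apply: lerXn2r; rewrite ?nnegrE.
- by rewrite !mulr_ge0 // ltW.
- by rewrite mulr_ge0 ?sqr_ge0.
have -> : 4^-1 * (eps * mu) ^+ 2 = (eps ^+ 2 * mu) * (4^-1 * mu) by ring.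
have -> : 24 * Gam * mu = (96 * Gam) * (4^-1 * mu) by field.
by rewrite ler_wpM2r // mulr_ge0 // ltW.
Qed.

End Selectors.

(** * Random signs and the Fourier matrix *)

(** Khintchine's inequality for the Euclidean norm without a dimension factor: the power mean
    inequality is used with the variances [v k] as weights, and the normalized coordinates all obey
    the same scalar bound. *)
Lemma rademacher_vector_moment (R : realFieldType) (J L : finType) (D : pred L)
    (a : J -> L -> R) (q : nat) : (0 < q)%N ->
  Ex 2^-1 (fun e => (\sum_(k | D k) rsum (a^~ k) e ^+ 2) ^+ q) <=
  (4 * q%:R * \sum_(k | D k) \sum_j a j k ^+ 2) ^+ q.
Proof.
case: q => // q _; pose v k : R := if D k then \sum_j a j k ^+ 2 else 0.
have s0 k : 0 <= \sum_j a j k ^+ 2 by apply: sumr_ge0 => j _; exact: sqr_ge0.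
have v0 k : 0 <= v k by rewrite /v; case: ifP.
have half01 : 0 <= (2^-1 : R) <= 1 by lra.
pose h k e := rsum (a^~ k) e ^+ 2 / v k.
have h0 k e : 0 <= h k e by rewrite mulr_ge0 ?invr_ge0 ?sqr_ge0.
have vh e : \sum_(k | D k) rsum (a^~ k) e ^+ 2 = \sum_k v k * h k e.
  rewrite big_mkcond; apply: eq_bigr => k _; rewrite /h /v.
  case: ifP => _; last by rewrite mul0r.
  (* A coordinate of variance zero has [h k e = 0] by the convention for division, and its
     Rademacher sum vanishes as well. *)
  have [z|z] := eqVneq (\sum_j a j k ^+ 2) 0; last by rewrite mulrC divfK.
  rewrite /rsum big1 ?expr0n ?mul0r ?mulr0 // => j _.
  have /(_ j isT) /eqP := psumr_eq0P (fun i _ => sqr_ge0 (a i k)) z.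
  by rewrite sqrf_eq0 => /eqP ->; rewrite mulr0.
rewrite (eq_Ex _ (g := fun e => (\sum_k v k * h k e) ^+ q.+1)); last by move=> e; rewrite vh.
have -> : \sum_(k | D k) \sum_j a j k ^+ 2 = \sum_k v k by rewrite big_mkcond.
apply: (@le_trans _ _ (Ex 2^-1 (fun e => (\sum_k v k) ^+ q * \sum_k v k * h k e ^+ q.+1))).
  by apply: Ex_le => // e; exact: sum_pow_le.
rewrite ExZ Ex_sum; apply: (@le_trans _ _ ((\sum_k v k) ^+ q * \sum_k v k * (4 * q.+1%:R) ^+ q.+1)).
  apply: ler_wpM2l; first by rewrite exprn_ge0 // sumr_ge0.
  apply: ler_sum => k _; rewrite ExZ.
  have [vk0|vk0] := eqVneq (v k) 0; first by rewrite vk0 !mul0r.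
  apply: ler_wpM2l => //.
  have vkE : v k = \sum_j a j k ^+ 2 by move: vk0; rewrite /v; case: ifP; rewrite ?eqxx.
  rewrite (eq_Ex _ (g := fun e => (v k ^+ q.+1)^-1 * rsum (a^~ k) e ^+ (2 * q.+1))).
    rewrite ExZ; apply: le_trans (ler_wpM2l _ (rademacher_moment _ _)) _.
      by rewrite invr_ge0 exprn_ge0.
    by rewrite -vkE exprMn mulrC mulfK // expf_neq0.
  by move=> e; rewrite /h exprMn exprVn -exprM mulrC.
by rewrite -mulr_suml mulrA -exprSr [leRHS]exprMn [leRHS]mulrC.
Qed.

(** * Orthogonality of the Fourier matrix in real form *)

Section Fourier.
Context {R : realType} (n : nat).

(* The real and the imaginary part (up to sign) of [sqrt n] times the DFT entry. *)
Definition fourier (j : 'I_n) (c : bool) (i : 'I_n) : R :=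
  let t : R := 2 * pi * (j * i)%:R / n%:R in if c then cos t else sin t.

Lemma fourier_sqr_le1 j c i : fourier j c i ^+ 2 <= 1.
Proof.
rewrite /fourier -(real_normK (num_real _)) expr_le1 //.
by case: c; rewrite ?cos_max ?sin_max.
Qed.

(** The Dirichlet kernel: [2 sin h cos (2 j h)] is the difference of the sines of [(2 j + 1) h] and
    [(2 j - 1) h]. *)
Lemma sum_cos_telescope (h : R) (N : nat) :
  2 * sin h * \sum_(j < N) cos (j%:R * (2 * h)) = sin (N%:R * (2 * h) - h) + sin h.
Proof.
elim: N => [|N IH]; first by rewrite big_ord0 mulr0 mul0r sub0r sinN addNr.
rewrite big_ord_recr mulrDr IH /=.
have -> : N.+1%:R * (2 * h) - h = N%:R * (2 * h) + h by rewrite -natr1; ring.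
by rewrite !sinD cosN sinN; ring.
Qed.

Lemma sum_cos_eq0 (k : nat) : (0 < k < n)%N ->
  \sum_(j < n) cos (2 * pi * (j * k)%:R / n%:R) = 0 :> R.
Proof.
move=> /andP[k0 kn]; have n0 : n%:R != 0 :> R by rewrite pnatr_eq0; lia.
pose h : R := pi * k%:R / n%:R.
have hs : 0 < sin h.
  apply: sin_gt0_pi; rewrite /h.
  have n0' : 0 < n%:R :> R by rewrite ltr0n; lia.
  have k0' : 0 < k%:R :> R by rewrite ltr0n.
  rewrite divr_gt0 ?mulr_gt0 ?pi_gt0 //= ltr_pdivrMr //.
  by rewrite ltr_pM2l ?pi_gt0 // ltr_nat.
have -> : \sum_(j < n) cos (2 * pi * (j * k)%:R / n%:R) = \sum_(j < n) cos (j%:R * (2 * h)) :> R.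
  by apply: eq_bigr => j _; congr cos; rewrite natrM /h; ring.
apply/eqP; have := sum_cos_telescope h n.
have -> : n%:R * (2 * h) - h = - h + (pi *+ 2) *+ k.
  by rewrite /h -mulr_natr -(mulr_natr pi); field.
rewrite (periodicn (@sinD2pi R)) sinN addNr => /eqP.
by rewrite mulf_eq0 mulf_eq0 pnatr_eq0 /= (gt_eqF hs).
Qed.

(** Summing over [c] gives the cosine of the difference of the angles. The indices are ordered first
    because the subtraction of naturals is truncated. *)
Lemma fourier_orthogonal (i i' : 'I_n) :
  \sum_j \sum_c fourier j c i * fourier j c i' = if i == i' then n%:R else 0.
Proof.
have E (j a b : 'I_n) : (b <= a)%N ->
    \sum_c fourier j c a * fourier j c b = cos (2 * pi * (j * (a - b))%:R / n%:R).
  move=> ba; rewrite big_bool /fourier /= -cosB; congr cos.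
  by rewrite -mulrBl -mulrBr mulnBr natrB // leq_mul2l ba orbT.
have C (j a b : 'I_n) : \sum_c fourier j c a * fourier j c b =
    \sum_c fourier j c b * fourier j c a by apply: eq_bigr => c _; rewrite mulrC.
case: eqP => [->|/eqP ne].
  under eq_bigr do rewrite (E _ _ _ (leqnn _)) subnn muln0 mulr0 mul0r cos0.
  by rewrite sumr_const card_ord.
wlog lt : i i' ne / (i' < i)%N.
  move=> W; case: (ltngtP i' i) => [lt|lt|/ord_inj/eqP]; first exact: W.
    by under eq_bigr do rewrite C; apply: W; rewrite // eq_sym.
  by rewrite eq_sym (negbTE ne).
under eq_bigr do rewrite (E _ _ _ (ltnW lt)).
by apply: sum_cos_eq0; rewrite subn_gt0 lt /=; apply: leq_ltn_trans (leq_subr _ _) (ltn_ord i).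
Qed.

Lemma fourier_parseval (v : 'I_n -> R) :
  \sum_j \sum_c (\sum_i fourier j c i * v i) ^+ 2 = n%:R * \sum_i v i ^+ 2.
Proof.
have -> : \sum_j \sum_c (\sum_i fourier j c i * v i) ^+ 2 =
   \sum_i \sum_i' v i * v i' * \sum_j \sum_c fourier j c i * fourier j c i'.
  have -> : \sum_j \sum_c (\sum_i fourier j c i * v i) ^+ 2 =
     \sum_j \sum_c \sum_i \sum_i' v i * v i' * (fourier j c i * fourier j c i').
    apply: eq_bigr => j _; apply: eq_bigr => c _; rewrite expr2 big_distrlr /=.
    by apply: eq_bigr => i _; apply: eq_bigr => i' _; ring.
  under eq_bigr do (rewrite exchange_big; under eq_bigr do rewrite exchange_big).
  rewrite exchange_big; apply: eq_bigr => i _; rewrite exchange_big.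
  apply: eq_bigr => i' _; rewrite mulr_sumr; apply: eq_bigr => j _.
  by rewrite mulr_sumr.
rewrite mulr_sumr; apply: eq_bigr => i _; rewrite (bigD1 i) //= [X in _ + X]big1 => [|i' ne].
  by rewrite fourier_orthogonal eqxx addr0 mulrC -expr2.
by rewrite fourier_orthogonal eq_sym (negbTE ne) mulr0.
Qed.

End Fourier.

(** * Distortion of the sketched quadratic form *)

Section SketchedForm.
Context {R : realType} (n : nat) (m : R).

(** The squared norm of the sketch of [w]: the factors [n / m] of the selectors and [1 / n] of the
    DFT combine to [m^-1], and a selector equals its square. *)
Definition sketch_form (e th : {ffun 'I_n -> bool}) (w : 'I_n -> R) : R :=
  m^-1 * \sum_j (th j)%:R * \sum_c (\sum_i fourier j c i * (sgn (e i) * w i)) ^+ 2.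

Context {I B : finType} (blk : I -> B) (l0 : B) (A : 'I_n -> I -> R) (S M rho : R).
Context (X : (I -> R) -> Prop) (eps : R) (K nu T0 q q1 : nat).

Let p : R := m / n%:R.

Hypothesis m_gt0 : 0 < m.
Hypothesis m_le : m <= n%:R.
Hypothesis M_gt0 : 0 < M.
Hypothesis rho_gt0 : 0 < rho.
Hypothesis eps01 : 0 < eps <= 1.
Hypothesis AS : forall l, \sum_(k | blk k == l) \sum_i A i k ^+ 2 <= S ^+ 2.
Hypothesis MS : M ^+ 2 = 16 * q1%:R * S ^+ 2.
Hypothesis q1_gt0 : (0 < q1)%N.
Hypothesis q_gt0 : (0 < q)%N.
Hypothesis X_norm : forall x, X x -> sum_norm blk x <= rho.
Hypothesis X_scale : forall x, X x -> \sum_i (dot (A i) x) ^+ 2 <= 4.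
Hypothesis nuP : (4 * n + 1 <= 2 ^ nu)%N.
Hypothesis KP : (#|I| <= 2 ^ K <= 2 * #|I|)%N.
Hypothesis T0P : 12 * (1 + ln #|B|%:R) < T0%:R :> R.
Hypothesis mP : 96 * chain_factor K nu T0 q * (M * rho) ^+ 2 <= eps ^+ 2 * m.

Definition mixed_row (e : {ffun 'I_n -> bool}) (j : 'I_n) (c : bool) (k : I) : R :=
  \sum_i fourier j c i * (sgn (e i) * A i k).

Definition spread (e : {ffun 'I_n -> bool}) : bool :=
  [forall j, forall c, forall l, block_sq blk (mixed_row e j c) l <= M ^+ 2].

Definition distorted (e th : {ffun 'I_n -> bool}) (x : I -> R) : Prop :=
  eps < `|sketch_form e th (fun i => dot (A i) x) - \sum_i dot (A i) x ^+ 2|.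

Definition failure (e th : {ffun 'I_n -> bool}) : bool :=
  `[< exists x, X x /\ distorted e th x >].

Let n_gt0 : (0 < n)%N.
Proof. by rewrite -(ltr0n R); apply: lt_le_trans m_gt0 m_le. Qed.

Let p01 : 0 <= p <= 1.
Proof.
have n0 : 0 < n%:R :> R by rewrite ltr0n.
by rewrite /p divr_ge0 ?(ltW m_gt0) //= ler_pdivrMr // mul1r.
Qed.

(** Markov's inequality for the [q1]-th moment and a union bound over rows, real or imaginary parts,
    and blocks; [M ^+ 2] is four times the base of the moment bound. *)
Lemma spread_tail : \sum_(e | ~~ spread e) bern 2^-1 e <= (2 * n * #|B|)%:R * 4^-1 ^+ q1 :> R.
Proof.
have half01 : 0 <= (2^-1 : R) <= 1 by lra.
pose viol (k : 'I_n * bool * B) (e : {ffun 'I_n -> bool}) :=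
  M ^+ 2 < block_sq blk (mixed_row e k.1.1 k.1.2) k.2.
apply: (@le_trans _ _ (\sum_k \sum_(e | viol k e) bern 2^-1 e)).
  under [leRHS]eq_bigr do rewrite big_mkcond.
  rewrite exchange_big /= big_mkcond; apply: ler_sum => e _.
  case: ifPn => [|_]; last by apply: sumr_ge0 => k _; case: ifP; rewrite ?bern_ge0.
  rewrite /spread negb_forall => /existsP[j]; rewrite negb_forall => /existsP[c].
  rewrite negb_forall => /existsP[l]; rewrite -ltNge => v.
  rewrite (bigD1 (j, c, l)) //= /viol /= v lerDl.
  by apply: sumr_ge0 => k _; case: ifP; rewrite ?bern_ge0.
have -> : (2 * n * #|B|)%:R * 4^-1 ^+ q1 = \sum_(k : 'I_n * bool * B) 4^-1 ^+ q1 :> R.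
  by rewrite sumr_const !card_prod card_ord card_bool (mulnC n) -[RHS]mulr_natl.
apply: ler_sum => -[[j c] l] _; rewrite /viol /=.
have M2 : 0 < M ^+ 2 by rewrite exprn_gt0.
have c0 : 0 < (M ^+ 2) ^+ q1 by rewrite exprn_gt0.
apply: le_trans (markov (f := fun e => block_sq blk (mixed_row e j c) l ^+ q1) half01 c0 _ _) _.
- by move=> e; rewrite exprn_ge0 ?block_sq_ge0.
- by move=> e v; apply: lerXn2r; rewrite ?nnegrE ?block_sq_ge0 ?(ltW M2) // ltW.
rewrite ler_pdivrMr //.
rewrite (eq_Ex _ (g := fun e => (\sum_(k | blk k == l)
   rsum ((fun i k => fourier j c i * A i k)^~ k) e ^+ 2) ^+ q1)); last first.
  move=> e; congr (_ ^+ _); apply: eq_bigr => k _; congr (_ ^+ _).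
  by apply: eq_bigr => i _; rewrite mulrCA.
apply: le_trans (rademacher_vector_moment _ _ q1_gt0) _.
rewrite -exprMn MS; apply: lerXn2r; rewrite ?nnegrE.
- apply: mulr_ge0; first by rewrite mulr_ge0.
  by apply: sumr_ge0 => k _; apply: sumr_ge0 => i _; exact: sqr_ge0.
- by rewrite -MS mulr_ge0 // ltW.
have -> : 4^-1 * (16 * q1%:R * S ^+ 2) = 4 * q1%:R * S ^+ 2 by field.
apply: ler_wpM2l; first by rewrite mulr_ge0.
apply: le_trans (AS l); apply: ler_sum => k _; apply: ler_sum => i _.
by rewrite exprMn ler_piMl ?sqr_ge0 ?fourier_sqr_le1.
Qed.

Lemma dot_mixed_row e j c (x : I -> R) :
  dot (mixed_row e j c) x = \sum_i fourier j c i * (sgn (e i) * dot (A i) x).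
Proof.
rewrite /dot /mixed_row; under eq_bigr do rewrite mulr_suml.
rewrite exchange_big; apply: eq_bigr => i _; rewrite !mulr_sumr.
by apply: eq_bigr => k _; rewrite !mulrA.
Qed.

(** One distorted point is chosen per failing selector pattern. These points form a finite family
    indexed by an [option] type, where [None] is the zero point that starts the chain; rows are
    scaled by [M^-1] and points by [rho^-1]. *)
Lemma spread_failure e : spread e -> \sum_(th | failure e th) bern p th <= 6 * 4^-1 ^+ q.
Proof.
move=> /forallP sp; pose MR := M * rho.
have MR0 : 0 < MR by rewrite mulr_gt0.
have MR2 : 0 < MR ^+ 2 by rewrite exprn_gt0.
have nR0 : n%:R != 0 :> R by rewrite pnatr_eq0 -lt0n.
have [w wP] : exists w : {ffun 'I_n -> bool} -> I -> R,
    forall th, failure e th -> X (w th) /\ distorted e th (w th).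
  suff /choice[w wP] : forall th, exists x, failure e th -> X x /\ distorted e th x by exists w.
  move=> th; case: (boolP (failure e th)) => [/asboolP[x]|_]; first by exists x.
  by exists (fun=> 0).
pose x (tau : option {ffun 'I_n -> bool}) (k : I) : R :=
  if tau is Some th then if failure e th then rho^-1 * w th k else 0 else 0.
pose r j c k : R := M^-1 * mixed_row e j c k.
have r1 j c l : block_sq blk (r j c) l <= 1.
  have -> : block_sq blk (r j c) l = M ^- 2 * block_sq blk (mixed_row e j c) l.
    by rewrite /block_sq mulr_sumr; apply: eq_bigr => k _; rewrite exprMn exprVn.
  rewrite mulrC ler_pdivrMr ?exprn_gt0 // mul1r.
  by have /forallP /(_ c) /forallP /(_ l) := sp j.
have sumZ (a : R) (y : I -> R) : 0 <= a -> sum_norm blk (fun k => a * y k) = a * sum_norm blk y.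
  move=> a0; rewrite /sum_norm mulr_sumr; apply: eq_bigr => l _.
  rewrite -[X in X * _](ger0_norm a0) -sqrtr_sqr -sqrtrM ?sqr_ge0 //; congr Num.sqrt.
  by rewrite /block_sq mulr_sumr; apply: eq_bigr => k _; rewrite exprMn.
have sum0 : sum_norm blk (fun=> 0 : R) = 0.
  rewrite /sum_norm /block_sq big1 // => l _.
  by rewrite big1 ?sqrtr0 // => k _; rewrite expr0n.
have x1 tau : sum_norm blk (x tau) <= 1.
  case: tau => [th|]; rewrite /x; last by rewrite sum0.
  case: (boolP (failure e th)) => [/wP[Xw _]|_]; last by rewrite sum0.
  rewrite sumZ ?invr_ge0 ?(ltW rho_gt0) //.
  by rewrite mulrC ler_pdivrMr // mul1r X_norm.
have QE th j : failure e th -> qform r (x (Some th)) j =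
    MR ^- 2 * \sum_c (\sum_i fourier j c i * (sgn (e i) * dot (A i) (w th))) ^+ 2.
  move=> fth; rewrite /qform mulr_sumr; apply: eq_bigr => c _; rewrite -dot_mixed_row /x fth.
  have -> : dot (r j c) (fun k => rho^-1 * w th k) = MR^-1 * dot (mixed_row e j c) (w th).
    rewrite /dot mulr_sumr; apply: eq_bigr => k _.
    by rewrite /r /MR invfM; ring.
  by rewrite exprMn exprVn.
have Q0 j tau : (forall k, x tau k = 0) -> qform r (x tau) j = 0.
  move=> x0; rewrite /qform big1 // => c _; rewrite /dot big1 ?expr0n // => k _.
  by rewrite x0 mulr0.
have isom (v : I -> R) : \sum_j \sum_c
    (\sum_i fourier j c i * (sgn (e i) * dot (A i) v)) ^+ 2 = n%:R * \sum_i dot (A i) v ^+ 2.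
  rewrite fourier_parseval; congr (_ * _); apply: eq_bigr => i _.
  by rewrite exprMn /sgn; case: (e i); rewrite ?sqrrN expr1n mul1r.
(* With this [mu] the selector deviation is [mu] times the distortion, so the threshold in
   [selector_tail] is exactly [eps]. *)
have [mu muE] : exists mu, mu = m / MR ^+ 2 by exists (m / MR ^+ 2).
have mu0 : 0 < mu by rewrite muE divr_gt0.
have pn : p * n%:R = m by rewrite /p divfK.
have mean tau : p * \sum_j qform r (x tau) j <= 4 * mu.
  case: tau => [th|]; last by rewrite big1 ?mulr0 ?mulr_ge0 ?(ltW mu0) // => j _; exact: Q0.
  case: (boolP (failure e th)) => fth; last first.
    rewrite big1 ?mulr0 ?mulr_ge0 ?(ltW mu0) // => j _; apply: Q0 => k.
    by rewrite /x (negbTE fth).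
  have [Xw _] := wP _ fth.
  under eq_bigr do rewrite (QE _ _ fth).
  rewrite -mulr_sumr isom.
  have -> : p * (MR ^- 2 * (n%:R * \sum_i dot (A i) (w th) ^+ 2)) =
     (p * n%:R) / MR ^+ 2 * \sum_i dot (A i) (w th) ^+ 2 by ring.
  by rewrite pn -muE [leRHS]mulrC; apply: ler_wpM2l (ltW mu0) _ _ (X_scale Xw).
have Gam0 : 0 <= chain_factor K nu T0 q :> R.
  exact: (mulr_ge0 (sqr_ge0 _) (mulr_ge0 (ler0n _ _) (ler0n _ _))).
have Gmu : 96 * chain_factor K nu T0 q <= eps ^+ 2 * mu.
  by rewrite muE mulrA ler_pdivlMr.
have Gmu' : chain_factor K nu T0 q <= mu.
  have : eps ^+ 2 * mu <= mu.
    by case/andP: eps01 => e0 e1; rewrite ler_piMl ?(ltW mu0) // expr_le1 // ltW.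
  by move: Gmu Gam0; set G := chain_factor _ _ _ _; lra.
have J0 : (0 < #|'I_n|)%N by rewrite card_ord.
have nuP' : (4 * #|'I_n| + 1 <= 2 ^ nu)%N by rewrite card_ord.
have chain (t : 'I_n -> R) (s2 : R) (xi : {ffun 'I_n -> bool} -> option {ffun 'I_n -> bool}) :
  (forall j, `|t j| <= 1) -> (forall tau, \sum_j `|t j| * qform r (x tau) j <= s2) ->
  Ex 2^-1 (fun e => rsum (fun j => t j * qform r (x (xi e)) j) e ^+ (2 * q)) <=
  (chain_factor K nu T0 q * s2) ^+ q.
  move=> t1 ts.
  exact: (chaining_moment (tau0 := None) l0 r1 x1 (fun=> erefl) t1 ts J0 nuP' KP T0P xi q_gt0).
have [e0 _] := andP eps01.
apply: le_trans (selector_tail None (fun tau j => qform_ge0 r (x tau) j) p01 Gam0 Gmu' mean chain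
   e0 mu0 Gmu).
rewrite big_mkcond [leRHS]big_mkcond; apply: ler_sum => th _.
case: ifPn => fth; last by case: ifP => // _; exact: bern_ge0.
suff -> : [exists tau, eps * mu < `|selector_dev (fun tau j => qform r (x tau) j) p th tau|] by [].
apply/existsP; exists (Some th); have [_] := wP _ fth; rewrite /distorted.
rewrite /selector_dev.
have -> : \sum_j ((th j)%:R - p) * qform r (x (Some th)) j =
   mu * (sketch_form e th (fun i => dot (A i) (w th)) - \sum_i dot (A i) (w th) ^+ 2).
  under eq_bigr do rewrite (QE _ _ fth) mulrBl.
  rewrite sumrB -mulr_sumr -mulr_sumr isom mulrBr; congr (_ - _); last first.
    have -> : p * (MR ^- 2 * (n%:R * \sum_i dot (A i) (w th) ^+ 2)) =
      (p * n%:R) / MR ^+ 2 * \sum_i dot (A i) (w th) ^+ 2 by ring.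
    by rewrite pn -muE.
  have mMR (Y : R) : m / MR ^+ 2 * (m^-1 * Y) = MR ^- 2 * Y.
    by field; rewrite !gt_eqF.
  rewrite /sketch_form muE mMR mulr_sumr.
  by apply: eq_bigr => j _; rewrite mulrCA.
by rewrite normrM (gtr0_norm mu0) mulrC ltr_pM2l.
Qed.

Theorem failure_probability :
  \sum_(k | failure k.1 k.2) bern 2^-1 k.1 * bern p k.2 <=
  (2 * n * #|B|)%:R * 4^-1 ^+ q1 + 6 * 4^-1 ^+ q :> R.
Proof.
have half01 : 0 <= (2^-1 : R) <= 1 by lra.
have -> : \sum_(k | failure k.1 k.2) bern 2^-1 k.1 * bern p k.2 =
    \sum_e bern 2^-1 e * \sum_(th | failure e th) bern p th :> R.
  rewrite big_mkcond /= -(pair_bigA _ (fun e th =>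
     if failure e th then bern 2^-1 e * bern p th else 0)) /=.
  apply: eq_bigr => e _; rewrite mulr_sumr [RHS]big_mkcond /=.
  by apply: eq_bigr => th _; case: ifP.
rewrite (bigID spread) /= addrC; apply: lerD.
  apply: le_trans spread_tail; apply: ler_sum => e _.
  rewrite ler_piMr ?bern_ge0 // -(sum_bern (J := 'I_n) p) [leLHS]big_mkcond.
  by apply: ler_sum => th _; case: ifP => // _; exact: bern_ge0.
have c0 : 0 <= 6 * 4^-1 ^+ q :> R by rewrite mulr_ge0 // exprn_ge0 // invr_ge0.
apply: (@le_trans _ _ (\sum_(e | spread e) bern 2^-1 e * (6 * 4^-1 ^+ q))).
  by apply: ler_sum => e se; rewrite ler_wpM2l ?bern_ge0 // spread_failure.
rewrite -mulr_suml -[leRHS]mul1r; apply: ler_wpM2r => //.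
rewrite -[leRHS](@sum_bern R 'I_n 2^-1) [leLHS]big_mkcond.
by apply: ler_sum => e _; case: ifP => // _; exact: bern_ge0.
Qed.

End SketchedForm.

(** * Choice of the parameters *)

Section SketchConstants.
Context {R : realType}.

Lemma expR1_le4 : expR 1 <= 4 :> R.
Proof.
have -> : 1 = 2^-1 + 2^-1 :> R by field.
have h := @expR_le_quad R 2^-1 (lexx _); have p := expR_ge0 (2^-1 : R).
rewrite expRD; apply: (@le_trans _ _ (2 * 2)); last by lra.
by apply: ler_pM => //; apply: le_trans h _; lra.
Qed.

(** Turns logarithms into integer exponents, since e is at most 4. *)
Lemma pow4_above_exists (y : R) : 1 <= y -> exists t : nat, t%:R <= ln y + 1 /\ y <= 4 ^+ t.
Proof.
move=> y1; have y0 : 0 < y by lra.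
have /andP[h1 h2] := truncn_itv (ln_ge0 y1).
exists (Num.truncn (ln y)).+1; split; first by rewrite -natr1 lerD2r.
rewrite -[leLHS](lnK (x := y)) ?posrE //.
apply: (@le_trans _ _ (expR (Num.truncn (ln y)).+1%:R)); first by rewrite ler_expR ltW.
rewrite -[_.+1%:R]mulr1 expRM_natl; apply: lerXn2r; rewrite ?nnegrE ?expR_ge0 //.
exact: expR1_le4.
Qed.

Lemma log1_ge1 k : 1 <= log1 R k.
Proof. by rewrite /log1 le_max lexx. Qed.

Lemma ln_le_log1 k : ln k%:R <= log1 R k.
Proof. by rewrite /log1 le_max lexx orbT. Qed.

(** Absorbs the extra block and the extra coordinate of the augmented problem. *)
Lemma ln_succ_le k : (0 < k)%N -> ln k.+1%:R <= 2 * log1 R k.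
Proof.
move=> k0; have k0' : 0 < k%:R :> R by rewrite ltr0n.
apply: (@le_trans _ _ (ln (2 * k%:R))).
  rewrite ler_ln ?posrE ?mulr_gt0 ?ltr0n // -natrM ler_nat; lia.
rewrite lnM ?posrE //; have := ln_le_log1 k; have := log1_ge1 k.
have : ln 2 <= 1 :> R by have := @le_ln1Dx R 1; rewrite (_ : 1 + 1 = 2) //; apply; lra.
by lra.
Qed.

Lemma two_pow_bound d : (0 < d)%N -> exists K : nat,
  (d.+1 <= 2 ^ K <= 2 * d.+1)%N /\ (K + 2)%:R <= 8 * log1 R d.
Proof.
move=> d0; exists (up_log 2 d.+1).
have d2 : (1 < d.+1)%N by [].
have /andP[h1 h2] := up_log_bounds (isT : (1 < 2)%N) d2.
set K := up_log _ _ in h1 h2 *.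
have K0 : (0 < K)%N by move: h2; case: (K) => //; rewrite expn0; lia.
have KE : (2 ^ K = 2 * 2 ^ K.-1)%N by rewrite -expnS prednK.
split; first by rewrite h2 KE; lia.
have L1 := log1_ge1 d; have Ld := ln_succ_le d0.
have : K%:R <= 2 * (1 + ln d.+1%:R) :> R; last first.
  by rewrite natrD; have := ln_le_log1 d; lra.
have ln2 : 2^-1 <= ln 2 :> R.
  rewrite -[leLHS]expRK ler_ln ?posrE ?expR_gt0 //.
  by apply: le_trans (expR_le_quad (lexx _)) _; lra.
have ln2' : ln 2 <= 1 :> R by have := @le_ln1Dx R 1; rewrite (_ : 1 + 1 = 2) //; apply; lra.
have hK : K%:R * ln 2 <= ln 2 + ln d.+1%:R :> R.
  rewrite -lnM ?posrE // mulr_natl -lnXn // ler_ln ?posrE ?exprn_gt0 ?mulr_gt0 ?ltr0n //.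
  rewrite -natrX -natrM ler_nat KE; lia.
have : K%:R * 2^-1 <= K%:R * ln 2 :> R by rewrite ler_wpM2l.
by lra.
Qed.

(** The factors on the left are the orders of [5 * nu * T0 + q] and of [q1]. The bounds
    [lam <= lam ^+ 2 + 1] and [x + y <= 2 * (x * y)] fold their product into the shape of
    [beta_factor]. *)
Lemma log_product_le (lam x y : R) : 0 < lam -> 1 <= x -> 1 <= y ->
  (x * y + lam) * (x + y + lam) <= 4 * ((lam ^+ 2 + y + x) * (x * y)).
Proof.
move=> l0 x1 y1; have l1 : lam <= lam ^+ 2 + 1 by have := sqr_ge0 (lam - 1); lra.
have xy1 : 1 <= x * y by rewrite mulr_ege1.
have xy : x + y <= 2 * (x * y).
  have : 0 <= (x - 1) * (y - 1) by rewrite mulr_ge0 ?subr_ge0.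
  by lra.
have l20 := sqr_ge0 lam; have p0 : 0 <= x * y by lra.
have h1 : lam * (x + y) <= lam * (2 * (x * y)) by rewrite ler_wpM2l // ltW.
have h2 : lam * (x * y) <= (lam ^+ 2 + 1) * (x * y) by rewrite ler_wpM2r.
have h3 : lam ^+ 2 * 1 <= lam ^+ 2 * (x * y) by rewrite ler_wpM2l.
have h4 : 2 * (x * y) <= (x + y) * (x * y) by rewrite ler_wpM2r //; lra.
have E : (x * y + lam) * (x + y + lam) =
  (x + y) * (x * y) + lam * (x * y) + lam * (x + y) + lam ^+ 2 by ring.
have F : 4 * ((lam ^+ 2 + y + x) * (x * y)) =
  4 * (lam ^+ 2 * (x * y)) + 4 * ((x + y) * (x * y)) by ring.
by rewrite E F; lra.
Qed.

(** The 96 comes from [selector_tail], [8 ^+ 2] from [K + 2], 576 and 1299 = 5 * 7 * 37 + 4 from the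
    chaining factor, [16 * 6 * 4] from [M ^+ 2] and the doubled radius, the last 4 from
    [log_product_le]. *)
Definition sketch_constant : R := 96 * (8 ^+ 2 * (576 * 1299) * (16 * 6 * 4)) * 4.

Lemma sketch_constant_gt0 : 0 < sketch_constant.
Proof. by rewrite /sketch_constant -!natrX -!natrM ltr0n !muln_gt0. Qed.

Lemma sketch_parameters (n b d : nat) (eta : R) :
  (0 < n)%N -> (0 < b)%N -> (0 < d)%N -> 0 < eta < 1 ->
  exists K nu T0 q q1 : nat, [/\ [/\ (4 * n + 1 <= 2 ^ nu)%N,
      (d.+1 <= 2 ^ K <= 2 * d.+1)%N & 12 * (1 + ln b.+1%:R) < T0%:R :> R],
      (0 < q)%N /\ (0 < q1)%N,
      (2 * n * b.+1)%:R * 4^-1 ^+ q1 + 6 * 4^-1 ^+ q <= eta &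
      96 * chain_factor K nu T0 q * (16 * q1%:R * 4) <= sketch_constant * beta_factor n b d eta].
Proof.
move=> n0 b0 d0 /andP[e0 e1].
have [K [KP Kle]] := two_pow_bound d0.
have ei1 : 1 <= eta^-1 by rewrite invf_ge1 // ltW.
have n1 : 1 <= n%:R :> R by rewrite ler1n.
have b1 : 1 <= b.+1%:R :> R by rewrite ler1n.
pose lam := ln eta^-1.
have lam0 : 0 < lam by rewrite ln_gt0 // invf_gt1.
have [t [tle t4]] := pow4_above_exists ei1.
have [tn [tnle tn4]] := pow4_above_exists n1.
have [tb [tble tb4]] := pow4_above_exists b1.
rewrite -/lam in tle.
have {}tnle : tn%:R <= log1 R n + 1 by apply: le_trans tnle _; rewrite lerD2r ln_le_log1.
have {}tble : tb%:R <= 2 * log1 R b + 1.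
  by apply: le_trans tble _; rewrite lerD2r ln_succ_le.
have Ln1 := log1_ge1 n; have Lb1 := log1_ge1 b; have Ld1 := log1_ge1 d.
set Ln := log1 R n in tnle Ln1; set Lb := log1 R b in tble Lb1; set Ld := log1 R d in Kle Ld1.
have lb0 : 0 <= ln b.+1%:R :> R by apply: ln_ge0.
have lbs : ln b.+1%:R <= 2 * Lb by apply: ln_succ_le.
have z0 : 0 <= 12 * (1 + ln b.+1%:R) :> R by lra.
have [T0 [T01 T02]] : exists T0 : nat, 12 * (1 + ln b.+1%:R) < T0%:R :> R /\
    T0%:R <= 12 * (1 + ln b.+1%:R) + 1 :> R.
  have /andP[h1 h2] := truncn_itv z0.
  by exists (Num.truncn (12 * (1 + ln b.+1%:R) : R)).+1; split=> //; rewrite -natr1 lerD2r.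
have pos4 k : 0 < 4 ^+ k :> R by rewrite exprn_gt0.
(* Here [8 * 4 ^ tn >= 4 * n + 1], and each of the two tails is at most [eta / 8] because
   [2 / 4 ^ 2] and [6 / 4 ^ 3] are at most 1/8. *)
exists K, (3 + 2 * tn)%N, T0, (t + 3)%N, (2 + tn + tb + t)%N.
split; [split=> //| |  |].
- rewrite -(ler_nat R) natrX exprD exprM natrD natrM.
  have -> : 2 ^+ 2 = 4 :> R by ring.
  have -> : 2 ^+ 3 = 8 :> R by ring.
  by lra.
- by rewrite !addnS.
- have h1 : (2 * n * b.+1)%:R * 4^-1 ^+ (2 + tn + tb + t) <= eta / 8.
    rewrite exprVn ler_pdivrMr ?pos4 // !exprD !natrM.
    have : 2 * n%:R * b.+1%:R <= 2 * 4 ^+ tn * 4 ^+ tb :> R.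
      by apply: ler_pM => //; rewrite ?mulr_ge0 // ler_wpM2l.
    move=> /le_trans; apply.
    have ee : 1 <= eta * 4 ^+ t by rewrite mulrC -ler_pdivrMr // mul1r.
    have p : 0 <= 2 * 4 ^+ tn * 4 ^+ tb :> R by rewrite !mulr_ge0 // exprn_ge0.
    have -> : eta / 8 * (4 ^+ 2 * 4 ^+ tn * 4 ^+ tb * 4 ^+ t) =
      (2 * 4 ^+ tn * 4 ^+ tb) * (eta * 4 ^+ t) by field.
    by rewrite ler_peMr.
  have h2 : 6 * 4^-1 ^+ (t + 3) <= eta / 8.
    rewrite exprVn ler_pdivrMr ?pos4 // exprD.
    have ee : 1 <= eta * 4 ^+ t by rewrite mulrC -ler_pdivrMr // mul1r.
    have -> : eta / 8 * (4 ^+ t * 4 ^+ 3) = 8 * (eta * 4 ^+ t) by field.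
    by lra.
  by lra.
set nu := (3 + 2 * tn)%N; set q := (t + 3)%N; set q1 := (2 + tn + tb + t)%N.
have nule : nu%:R <= 7 * Ln by rewrite /nu natrD natrM; lra.
have T0le : T0%:R <= 37 * Lb by lra.
have qle : q%:R <= lam + 4 by rewrite /q natrD; lra.
have q1le : q1%:R <= 6 * (Ln + Lb + lam) by rewrite /q1 !natrD; lra.
clearbody nu q q1.
have LL1 : 1 <= Ln * Lb by rewrite mulr_ege1.
have nT : nu%:R * T0%:R <= (7 * Ln) * (37 * Lb) :> R by apply: ler_pM.
have mid : (5 * nu * T0 + q)%:R <= 1299 * (Ln * Lb + lam).
  by rewrite natrD !natrM -mulrA; lra.
have KK : (K + 2)%:R ^+ 2 <= 8 ^+ 2 * Ld ^+ 2.
  by rewrite -exprMn; apply: lerXn2r; rewrite ?nnegrE ?ler0n //; apply: mulr_ge0; lra.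
have lp := log_product_le lam0 Ln1 Lb1.
have B0 : 0 <= (lam ^+ 2 + Lb + Ln) * (Ln * Lb).
  by apply: mulr_ge0; [have := sqr_ge0 lam; lra | lra].
have bf : (lam ^+ 2 + Lb + Ln) * (Ln * Lb) * Ld ^+ 2 <= beta_factor n b d eta.
  rewrite /beta_factor -/Ln -/Lb -/Ld -/lam ler_wpM2r ?sqr_ge0 // mulrA.
  apply: ler_wpM2l; first by apply: mulr_ge0; [have := sqr_ge0 lam; lra | lra].
  by rewrite -[leLHS]expr1 ler_weXn2l.
apply: (@le_trans _ _ (sketch_constant * ((lam ^+ 2 + Lb + Ln) * (Ln * Lb) * Ld ^+ 2))); last first.
  by apply: ler_wpM2l => //; exact: ltW sketch_constant_gt0.
rewrite /chain_factor /sketch_constant.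
have [p96 p576 p1299] : [/\ 0 <= 96 :> R, 0 <= 576 :> R & 0 <= 1299 :> R].
  by split; exact: ler0n.
move: (96 : R) (576 : R) (1299 : R) p96 p576 p1299 mid => c96 c576 c1299 p96 p576 p1299 mid.
have Ld2 := sqr_ge0 Ld.
apply: (@le_trans _ _ (c96 * (8 ^+ 2 * Ld ^+ 2 * (c576 * (c1299 * (Ln * Lb + lam)))) *
    (16 * (6 * (Ln + Lb + lam)) * 4))).
  apply: ler_pM.
  - by apply: mulr_ge0 => //; apply: mulr_ge0; rewrite ?sqr_ge0 // mulr_ge0.
  - by rewrite !mulr_ge0.
  - apply: ler_wpM2l => //; apply: ler_pM; rewrite ?sqr_ge0 ?mulr_ge0 //.
    exact: ler_wpM2l.
  - by apply: ler_wpM2r => //; exact: ler_wpM2l.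
have -> : c96 * (8 ^+ 2 * Ld ^+ 2 * (c576 * (c1299 * (Ln * Lb + lam)))) *
    (16 * (6 * (Ln + Lb + lam)) * 4) =
  (c96 * (8 ^+ 2 * (c576 * c1299) * (16 * 6 * 4)) * Ld ^+ 2) *
    ((Ln * Lb + lam) * (Ln + Lb + lam)) by ring.
have -> : c96 * (8 ^+ 2 * (c576 * c1299) * (16 * 6 * 4)) * 4 *
    ((lam ^+ 2 + Lb + Ln) * (Ln * Lb) * Ld ^+ 2) =
  (c96 * (8 ^+ 2 * (c576 * c1299) * (16 * 6 * 4)) * Ld ^+ 2) *
    (4 * ((lam ^+ 2 + Lb + Ln) * (Ln * Lb))) by ring.
have p8 : 0 <= 8 ^+ 2 :> R by exact: sqr_ge0.
have p384 : 0 <= 16 * 6 * 4 :> R by rewrite !mulr_ge0.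
apply: ler_wpM2l lp; apply: mulr_ge0 => //; apply: mulr_ge0 => //.
exact: mulr_ge0 (mulr_ge0 p8 (mulr_ge0 p576 p1299)) p384.
Qed.

End SketchConstants.

Local Open Scope classical_set_scope.
Local Open Scope ring_scope.

(** * From the random sketch to the least squares problem *)

Section Randomness.
Context {R : realType} {disp : measure_display} {T : measurableType disp}.
Context (P : probability T R) (n : nat) (m : R) (sigma theta : 'I_n -> {RV P >-> R}).
Hypothesis rand : fjlt_randomness m sigma theta.

Let cfg := ({ffun 'I_n -> bool} * {ffun 'I_n -> bool})%type.

Definition atom_target (k : cfg) (i : 'I_n + 'I_n) : R :=
  match i with inl i => sgn (k.1 i) | inr i => (k.2 i)%:R end.

Definition atom_bit (i : 'I_n + 'I_n) : {RV P >-> R} :=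
  match i with inl i => sigma i | inr i => theta i end.

Definition atom (k : cfg) : set T :=
  \bigcap_(i in [set` [set: 'I_n + 'I_n]%SET]) (atom_bit i @^-1` [set atom_target k i]).

Lemma measurable_atom k : measurable (atom k).
Proof.
apply: fin_bigcap_measurable; first exact: finite_finset.
by move=> i _; exact: measurable_funPTI.
Qed.

Lemma atomP (k : cfg) w : (forall i, sigma i w = sgn (k.1 i)) ->
  (forall i, theta i w = (k.2 i)%:R) -> atom k w.
Proof. by move=> hs ht [i|i] _ /=. Qed.

Lemma prob_atom k : P (atom k) = (bern 2^-1 k.1 * bern (m / n%:R) k.2)%:E.
Proof.
have [hs ht hind] := rand.
have -> : P (atom k) = (\prod_(i in [set: 'I_n + 'I_n]%SET)
    P (atom_bit i @^-1` [set atom_target k i]))%E.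
  rewrite /atom -(hind [set: 'I_n + 'I_n]%SET (fun i => [set atom_target k i])) //.
pose w i : R := match i with
  | inl i => if k.1 i then 2^-1 else 1 - 2^-1
  | inr i => if k.2 i then m / n%:R else 1 - m / n%:R end.
transitivity (\prod_(i : 'I_n + 'I_n) (w i)%:E)%E.
  apply: eq_big => [i|i _]; first by rewrite inE.
  case: i => i /=.
    have [_ h1 h2] := hs i; rewrite /sgn; case: (k.1 i) => //.
    by rewrite h2; congr EFin; lra.
  have [h01 h1] := ht i; case: (k.2 i) => //=.
  have -> : theta i @^-1` [set 0%:R] = ~` (theta i @^-1` [set 1]).
    apply/seteqP; split => x /=; first by move=> -> /esym/eqP; rewrite oner_eq0.
    by case: (h01 x).
  by rewrite probability_setC ?h1 //; exact: measurable_funPTI.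
rewrite -(big_morph EFin (id1 := 1%E) (op1 := mule) (id2 := 1) (op2 := *%R)) //; congr EFin.
by rewrite big_sumType.
Qed.

(** The event depends only on the values of finitely many signs and selectors. For any [Ev] it is
    the complement of a finite union of atoms, which makes it measurable and reduces the bound to
    subadditivity. *)
Lemma fjlt_probability (Ev : ('I_n -> R) -> ('I_n -> R) -> Prop) (eta : R) :
  \sum_(k : cfg | `[< ~ Ev (fun i => sgn (k.1 i)) (fun i => (k.2 i)%:R) >])
     bern 2^-1 k.1 * bern (m / n%:R) k.2 <= eta ->
  ((1 - eta)%:E <= P [set w | Ev (fun i => sigma i w) (fun i => theta i w)])%E.
Proof.
pose bad (k : cfg) := `[< ~ Ev (fun i => sgn (k.1 i)) (fun i => (k.2 i)%:R) >].
rewrite -/bad => sumbad.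
have [hs ht _] := rand.
pose U := \big[setU/set0]_(k | bad k) atom k.
have mU : measurable U by apply: bigsetU_measurable => k _; exact: measurable_atom.
have EU : [set w | Ev (fun i => sigma i w) (fun i => theta i w)] = ~` U.
  apply/seteqP; split => w /=.
    move=> ev; rewrite /U big_mkcond.
    apply: (big_ind (fun S : set T => ~ S w)) => [[]|S1 S2 h1 h2 [//|//]|k _].
    case: ifP => [/asboolP nev kw|_ []]; apply: nev; move: ev.
    have -> : (fun i => sigma i w) = (fun i => sgn (k.1 i)).
      by apply/funext => i; apply: (kw (inl i)); rewrite /= inE.
    have -> // : (fun i => theta i w) = (fun i => (k.2 i)%:R).
    by apply/funext => i; apply: (kw (inr i)); rewrite /= inE.
  pose k : cfg := ([ffun i => sigma i w == 1], [ffun i => theta i w == 1]).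
  have ks i : sigma i w = sgn (k.1 i).
    rewrite ffunE /sgn; have [/(_ w)[->|->] _ _] := hs i; rewrite ?eqxx //.
    by rewrite ifF //; apply/eqP; lra.
  have kt i : theta i w = (k.2 i)%:R.
    rewrite ffunE; have [/(_ w)[->|->] _] := ht i; rewrite ?eqxx //.
    by rewrite eq_sym oner_eq0.
  move=> nU; apply: contrapT => nev; apply: nU.
  rewrite /U (bigD1 k) /=; first by left; exact: atomP.
  apply/asboolP => ev; apply: nev; move: ev.
  have -> : (fun i => sigma i w) = (fun i => sgn (k.1 i)) by apply/funext => i; exact: ks.
  by have -> // : (fun i => theta i w) = (fun i => (k.2 i)%:R) by apply/funext => i; exact: kt.
rewrite EU probability_setC //.
have [_ PU] : measurable U /\
    (P U <= (\sum_(k | bad k) bern 2^-1 k.1 * bern (m / n%:R) k.2)%:E)%E.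
  rewrite /U; elim/big_rec2 : _ => [|k S s bk [mS IH]]; first by rewrite measure0.
  have mk := measurable_atom k; split; first exact: measurableU.
  apply: le_trans (measureU2 P mk mS) _; rewrite EFinD -prob_atom.
  exact: leeD2l.
have fU : P U \is a fin_num by apply: fin_num_measure.
rewrite -(fineK fU) -EFinB lee_fin lerD2l lerN2 -lee_fin fineK //.
by apply: le_trans PU _; rewrite lee_fin.
Qed.

End Randomness.

(** * The sketched objective as a real quadratic form *)

Section SketchIdentity.
Context {R : realType} (n : nat) (m : R).

Lemma sum_complex (I : finType) (a b : I -> R) :
  \sum_i (a i +i* b i)%C = ((\sum_i a i) +i* (\sum_i b i))%C.
Proof.
by elim/big_rec3 : _ => //= i x y z _ ->.
Qed.

Lemma sketched_lsq_form (d : nat) (e th : {ffun 'I_n -> bool}) (A : 'M[R]_(n, d))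
    (v : 'cV[R]_n) (x : 'cV[R]_d) : 0 < m -> (0 < n)%N ->
  sketched_lsq (fjlt m (fun i => sgn (e i)) (fun i => (th i)%:R)) A v x =
  sketch_form m e th (fun i => (A *m x - v) i 0).
Proof.
move=> m0 n0; rewrite /sketched_lsq.
set Psi := fjlt _ _ _.
have -> : Psi *m complexify A *m complexify x - Psi *m complexify v =
    Psi *m complexify (A *m x - v).
  rewrite -mulmxA -mulmxBr; congr (_ *m _).
  by rewrite /complexify map_mxB map_mxM.
set w := A *m x - v.
have n0' : 0 < n%:R :> R by rewrite ltr0n.
have ent j : (Psi *m complexify w) j 0 =
   (Num.sqrt (n%:R / m) * (th j)%:R)%:C%C *
   \sum_i ((fourier j true i / Num.sqrt n%:R * (sgn (e i) * w i 0)) +i*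
         - (fourier j false i / Num.sqrt n%:R * (sgn (e i) * w i 0)))%C.
  have cE (k l : nat) (M : 'M[R]_(k, l)) : complexify M = map_mx (real_complex R) M by [].
  rewrite /Psi /fjlt !cE map_mxZ !map_diag_mx -!scalemxAl -!mulmxA mxE mul_diag_mx.
  rewrite !mxE mulrA -rmorphM; congr (_ * _); apply: eq_bigr => i _.
  rewrite mul_diag_mx !mxE -rmorphM /fourier /=.
  by apply/eqP; rewrite eq_complex /=; apply/andP; split; apply/eqP; ring.
rewrite /l2normC sqr_sqrtr; last by apply: sumr_ge0 => j _; exact: sqr_ge0.
rewrite /sketch_form mulr_sumr; apply: eq_bigr => j _.
have E c : \sum_i fourier j c i / Num.sqrt n%:R * (sgn (e i) * w i 0) =
   (Num.sqrt n%:R)^-1 * \sum_i fourier j c i * (sgn (e i) * w i 0) :> R.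
  by rewrite mulr_sumr; apply: eq_bigr => i _; ring.
rewrite ent sum_complex sumrN !E Normc.normcM exprMn.
have nc (a b : R) : Normc.normc (a +i* b)%C ^+ 2 = a ^+ 2 + b ^+ 2.
  by rewrite /Normc.normc sqr_sqrtr // addr_ge0 ?sqr_ge0.
rewrite !nc expr0n addr0 big_bool sqrrN.
rewrite !exprMn exprVn !sqr_sqrtr ?ler0n //; last by rewrite divr_ge0 // ltW.
have -> : ((th j)%:R : R) ^+ 2 = (th j)%:R by case: (th j); rewrite ?expr1n ?expr0n.
set a := (\sum_i _) ^+ 2; set b := (\sum_i _) ^+ 2.
rewrite -[Monoid.ComLaw.sort _ a b]/(a + b).
by field; rewrite !gt_eqF.
Qed.

End SketchIdentity.

Lemma sum_option (V : nmodType) (I : finType) (D : pred (option I)) (F : option I -> V) :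
  \sum_(k | D k) F k = (if D None then F None else 0) + \sum_(k | D (Some k)) F (Some k).
Proof.
rewrite big_mkcond (bigD1 None) //=; congr (_ + _).
rewrite (reindex_omap Some id) /=; last by case.
by rewrite [RHS]big_mkcond; apply: eq_bigl => k; rewrite eqxx.
Qed.

(** * Polarization and first-order optimality *)

Section BilinearForm.
Context {R : realType} (n : nat) (m : R) (e th : {ffun 'I_n -> bool}).
Implicit Types u v : 'I_n -> R.

Let mixed v j c : R := \sum_i fourier j c i * (sgn (e i) * v i).

Definition sketch_bil u v : R :=
  m^-1 * \sum_j (th j)%:R * \sum_c mixed u j c * mixed v j c.

Let mixedD u v t j c : mixed (fun i => u i + t * v i) j c = mixed u j c + t * mixed v j c.
Proof. by rewrite /mixed mulr_sumr -big_split; apply: eq_bigr => i _ /=; ring. Qed.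

Lemma sketch_bilC u v : sketch_bil u v = sketch_bil v u.
Proof.
by congr (_ * _); apply: eq_bigr => j _; congr (_ * _); apply: eq_bigr => c _; rewrite mulrC.
Qed.

Lemma sketch_bil_diag v : sketch_bil v v = sketch_form m e th v.
Proof. by []. Qed.

Lemma sketch_bilD u v w t :
  sketch_bil (fun i => u i + t * v i) w = sketch_bil u w + t * sketch_bil v w.
Proof.
rewrite /sketch_bil [t * _]mulrCA -mulrDr; congr (_ * _).
rewrite mulr_sumr -big_split; apply: eq_bigr => j _ /=.
rewrite [t * _]mulrCA -mulrDr; congr (_ * _).
by rewrite mulr_sumr -big_split; apply: eq_bigr => c _ /=; rewrite mixedD; ring.
Qed.

Lemma sketch_formD u v t : sketch_form m e th (fun i => u i + t * v i) =
  sketch_form m e th u + 2 * t * sketch_bil u v + t ^+ 2 * sketch_form m e th v.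
Proof.
rewrite -!sketch_bil_diag sketch_bilD (sketch_bilC u (fun i => _)).
rewrite (sketch_bilC v (fun i => _)) !sketch_bilD.
by rewrite (sketch_bilC v u); ring.
Qed.

Lemma sketch_bilZ u v (a b : R) :
  sketch_bil (fun i => a * u i) (fun i => b * v i) = a * b * sketch_bil u v.
Proof.
have z w (c : R) x : sketch_bil (fun i => c * w i) x = c * sketch_bil w x.
  have -> : (fun i => c * w i) = (fun i => 0 * w i + c * w i).
    by apply/funext => i; rewrite mul0r add0r.
  rewrite sketch_bilD (_ : (fun i => 0 * w i) = (fun i => w i + (-1) * w i)).
    by rewrite sketch_bilD; ring.
  by apply/funext => i; ring.
by rewrite z sketch_bilC z sketch_bilC mulrA.
Qed.

End BilinearForm.

(** The linear term dominates for small [t]: if [beta] were negative, [t = - beta / (- beta + |c|)]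
    would violate the hypothesis. *)
Lemma directional_slope_ge0 (R : realFieldType) (beta c : R) :
  (forall t, 0 < t <= 1 -> 0 <= 2 * t * beta + t ^+ 2 * c) -> 0 <= beta.
Proof.
move=> h; rewrite leNgt; apply/negP => b0.
pose D := - beta + `|c|.
have D0 : 0 < D by rewrite /D ltr_pwDl // oppr_gt0.
pose t := - beta / D.
have tD : t * D = - beta by rewrite /t divfK ?gt_eqF.
have t0 : 0 < t by rewrite divr_gt0 // oppr_gt0.
have t1 : t <= 1 by rewrite ler_pdivrMr // mul1r lerDl.
have := h t; rewrite t0 t1 => /(_ isT).
have tc : t * c <= t * `|c| by rewrite ler_wpM2l ?ler_norm ?ltW.
have tb : t * `|c| <= - beta by rewrite -tD ler_wpM2l ?(ltW t0) // /D lerDr oppr_ge0 ltW.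
have : t * (2 * beta + t * c) < 0 by rewrite pmulr_rlt0 //; lra.
by rewrite expr2; lra.
Qed.

Lemma convex_set_segment (R : realType) (d : nat) (C : set 'cV[R]_d) (x y : 'cV[R]_d) (t : R) :
  convex_set C -> C x -> C y -> 0 < t <= 1 -> C (x + t *: (y - x)).
Proof.
move=> cC Cx Cy /andP[t0 t1].
have ti : Itv.spec (@Itv.num_sem R) (Itv.Real `[0%Z, 1%Z]) t.
  by rewrite /= /Itv.num_sem /= num_real in_itv /= t1 ltW.
pose l : {i01 R} := Itv.mk ti.
have := cC y x l; rewrite !inE => /(_ Cy Cx).
suff -> : conv l (y : convex_lmodType _) (x : convex_lmodType _) = x + t *: (y - x) by [].
rewrite /conv /= scalerBr scalerBl scale1r; set a := t *: y; set c := t *: x.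
by rewrite addrCA addrA [x + _]addrC -addrA addrC addrAC.
Qed.

Lemma l2norm_sqr (R : realType) (n : nat) (v : 'cV[R]_n) : l2norm v ^+ 2 = \sum_i v i 0 ^+ 2.
Proof. by rewrite sqr_sqrtr //; apply: sumr_ge0 => i _; exact: sqr_ge0. Qed.

(** Optimality of [xs] gives [<v, r> <= 0], and optimality of [xh] bounds the sketched form of [v]
    by the sketched cross term. Hence [(1 - eps) |v| <= eps |r|], and the residual of [xh] has norm
    at most [|v| + |r| <= |r| / (1 - eps)]. *)
Lemma lsq_le_of_sketch (R : realType) (n d : nat) (m : R) (e th : {ffun 'I_n -> bool})
    (A : 'M[R]_(n, d)) (b' : 'cV[R]_n) (C : set 'cV[R]_d) (xs xh : 'cV[R]_d) (eps : R) :
  let v i := (A *m (xh - xs)) i 0 in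
  let r i := (b' - A *m xs) i 0 in
  convex_set C -> is_minimizer (lsq A b') C xs ->
  is_minimizer (fun x => sketch_form m e th (fun i => (A *m x - b') i 0)) C xh ->
  0 < eps < 1 ->
  (1 - eps) * \sum_i v i ^+ 2 <= sketch_form m e th v ->
  sketch_bil m e th v r <= \sum_i v i * r i +
    eps * (Num.sqrt (\sum_i v i ^+ 2) * Num.sqrt (\sum_i r i ^+ 2)) ->
  lsq A b' xh <= (1 - eps) ^- 2 * lsq A b' xs.
Proof.
move=> v r cC [Cs mins] [Ch minh] /andP[e0 e1] lo hi.
have vE i : v i = (A *m xh) i 0 - (A *m xs) i 0.
  by rewrite /v mulmxBr !mxE.
have rE i : r i = b' i 0 - (A *m xs) i 0 by rewrite /r !mxE.
have opt_s : \sum_i v i * r i <= 0.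
  rewrite -oppr_ge0; apply: (@directional_slope_ge0 _ _ (\sum_i v i ^+ 2)) => t t01.
  have := mins _ (convex_set_segment cC Cs Ch t01).
  rewrite /lsq !l2norm_sqr -subr_ge0.
  suff -> : \sum_i (A *m (xs + t *: (xh - xs)) - b') i 0 ^+ 2 -
     \sum_i (A *m xs - b') i 0 ^+ 2 =
     2 * t * - (\sum_i v i * r i) + t ^+ 2 * \sum_i v i ^+ 2 by [].
  rewrite -sumrB -[X in 2 * t * X]sumrN !mulr_sumr -big_split; apply: eq_bigr => i _ /=.
  have -> : (A *m (xs + t *: (xh - xs)) - b') i 0 = t * v i - r i.
    by rewrite rE mulmxDr -scalemxAr !mxE /v !mxE; ring.
  have -> : (A *m xs - b') i 0 = - r i by rewrite rE !mxE; ring.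
  ring.
have opt_h : sketch_form m e th v <= sketch_bil m e th v r.
  rewrite -subr_ge0; apply: (@directional_slope_ge0 _ _ (sketch_form m e th v)) => t t01.
  have := minh _ (convex_set_segment cC Ch Cs t01).
  rewrite -subr_ge0.
  (* The residual at [xh] is [v - r], and the direction from [xh] to [xs] is mapped to [- v]. *)
  have -> : (fun i => (A *m (xh + t *: (xs - xh)) - b') i 0) =
      (fun i => (A *m xh - b') i 0 + (- t) * v i).
    apply/funext => i; rewrite vE mulmxDr -scalemxAr mulmxBr !mxE; ring.
  rewrite sketch_formD.
  have -> : (fun i => (A *m xh - b') i 0) = (fun i => v i + (-1) * r i).
    by apply/funext => i; rewrite vE rE !mxE; ring.
  rewrite sketch_bilD sketch_bil_diag (sketch_bilC _ _ _ r v).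
  by set f := sketch_form _ _ _ v; set g := sketch_form _ _ _ _; lra.
have v2 : 0 <= \sum_i v i ^+ 2 by apply: sumr_ge0 => i _; exact: sqr_ge0.
have r2 : 0 <= \sum_i r i ^+ 2 by apply: sumr_ge0 => i _; exact: sqr_ge0.
set a := Num.sqrt (\sum_i v i ^+ 2) in hi; set g := Num.sqrt (\sum_i r i ^+ 2) in hi.
have a0 : 0 <= a := sqrtr_ge0 _; have g0 : 0 <= g := sqrtr_ge0 _.
have a2 : a ^+ 2 = \sum_i v i ^+ 2 by rewrite sqr_sqrtr.
have g2 : g ^+ 2 = \sum_i r i ^+ 2 by rewrite sqr_sqrtr.
have ag : (1 - eps) * a <= eps * g.
  have [->|an0] := eqVneq a 0; first by rewrite mulr0 mulr_ge0 // ltW.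
  have ap : 0 < a by rewrite lt_neqAle eq_sym an0.
  by rewrite -(ler_pM2l ap); move: lo hi opt_h opt_s; rewrite -a2; lra.
have cs : - (\sum_i v i * r i) <= a * g.
  apply: le_trans (ler_norm _) _; rewrite normrN -sqrtr_sqr; apply: sqrt_le_of_sqr.
    by rewrite mulr_ge0.
  by rewrite exprMn a2 g2; exact: cauchy_schwarz_sum.
have -> : lsq A b' xs = g ^+ 2.
  rewrite /lsq l2norm_sqr g2; apply: eq_bigr => i _; rewrite rE !mxE; ring.
have -> : lsq A b' xh = a ^+ 2 - 2 * (\sum_i v i * r i) + g ^+ 2.
  rewrite /lsq l2norm_sqr a2 g2 mulr_sumr -sumrB -big_split; apply: eq_bigr => i _ /=.
  by rewrite vE rE !mxE; ring.
apply: (@le_trans _ _ ((a + g) ^+ 2)); first by rewrite sqrrD; lra.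
have p1 : 0 < 1 - eps by lra.
rewrite -exprVn -exprMn; apply: lerXn2r; rewrite ?nnegrE ?addr_ge0 //.
  by rewrite mulr_ge0 // invr_ge0 ltW.
by rewrite mulrC ler_pdivlMr //; lra.
Qed.

(** * The residual as an additional block *)

Section Augmented.
Context {R : realType} (n d b : nat) (blk : 'I_d -> 'I_b) (A : 'M[R]_(n, d)).
Let S := block_norm blk A.

Lemma block_norm_ge0 : 0 <= S.
Proof. by rewrite /S /block_norm; elim/big_rec : _ => // l x _ x0; rewrite le_max x0 orbT. Qed.

Lemma block_le_norm l : \sum_(k | blk k == l) \sum_i A i k ^+ 2 <= S ^+ 2.
Proof.
have h0 : 0 <= \sum_(j < n) \sum_(k < d | blk k == l) `|A j k| ^+ 2.
  by apply: sumr_ge0 => j _; apply: sumr_ge0 => k _; exact: sqr_ge0.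
rewrite exchange_big /=.
have -> : \sum_(j < n) \sum_(k < d | blk k == l) A j k ^+ 2 =
    Num.sqrt (\sum_(j < n) \sum_(k < d | blk k == l) `|A j k| ^+ 2) ^+ 2.
  rewrite sqr_sqrtr //; apply: eq_bigr => j _; apply: eq_bigr => k _.
  by rewrite real_normK ?num_real.
apply: lerXn2r; rewrite ?nnegrE ?sqrtr_ge0 ?block_norm_ge0 //.
by rewrite /S /block_norm; exact: le_bigmax.
Qed.

(** Cauchy-Schwarz on each block, then the power mean inequality weighted by the block norms of [x].
    It serves to bound [1 / S] by the (2,1)-norm of normalized points. *)
Lemma l2norm_mulmx_le (x : 'cV[R]_d) : l2norm (A *m x) ^+ 2 <= S ^+ 2 * norm21 blk x ^+ 2.
Proof.
pose w l := Num.sqrt (\sum_(k < d | blk k == l) x k 0 ^+ 2).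
pose a i l := Num.sqrt (\sum_(k < d | blk k == l) A i k ^+ 2).
have w0 l : 0 <= w l := sqrtr_ge0 _; have a0 i l : 0 <= a i l := sqrtr_ge0 _.
have W0 : 0 <= \sum_l w l by apply: sumr_ge0.
have asq i l : a i l ^+ 2 = \sum_(k < d | blk k == l) A i k ^+ 2.
  by rewrite sqr_sqrtr //; apply: sumr_ge0 => k _; exact: sqr_ge0.
have wsq l : w l ^+ 2 = \sum_(k < d | blk k == l) x k 0 ^+ 2.
  by rewrite sqr_sqrtr //; apply: sumr_ge0 => k _; exact: sqr_ge0.
rewrite l2norm_sqr.
apply: (@le_trans _ _ (\sum_i (\sum_l w l) * \sum_l w l * a i l ^+ 2)).
  apply: ler_sum => i _; apply: (@le_trans _ _ ((\sum_l w l * a i l) ^+ 2)); last first.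
    by have := sum_pow_le 1 w0 (a0 i); rewrite expr1.
  rewrite mxE (partition_big blk predT) //= -(real_normK (num_real (\sum_l \sum_(k | _) _))).
  apply: lerXn2r; rewrite ?nnegrE //.
    by apply: sumr_ge0 => l _; rewrite mulr_ge0.
  apply: le_trans (ler_norm_sum _ _ _) _; apply: ler_sum => l _.
  rewrite -sqrtr_sqr; apply: sqrt_le_of_sqr; first by rewrite mulr_ge0.
  by rewrite exprMn mulrC asq wsq; exact: cauchy_schwarz_sum.
rewrite -mulr_sumr exchange_big /=.
rewrite (_ : norm21 blk x = \sum_l w l) // [leRHS]mulrC expr2 -mulrA ler_wpM2l //.
rewrite mulr_suml; apply: ler_sum => l _; rewrite -mulr_sumr ler_wpM2l //.
apply: le_trans (block_le_norm l); rewrite exchange_big /=.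
by apply: ler_sum => i _; rewrite asq.
Qed.

Context (r : 'I_n -> R).
Let g := Num.sqrt (\sum_i r i ^+ 2).

(* Appending the normalized residual as an extra block turns the cross term of
   the sketch into a difference of two quadratic forms; the factor [S] keeps the
   block norm unchanged.  If [r = 0] the extra column is [0] as well. *)
Definition aug_mx (i : 'I_n) (k : option 'I_d) : R :=
  if k is Some k then A i k else S * (r i / g).

Definition aug_vec (x : 'cV[R]_d) (s : R) (k : option 'I_d) : R :=
  if k is Some k then x k 0 else s / S.

(** The points with [s = 0] carry the form on the cone; those with [s = 1] and [s = -1] carry the
    cross term by polarization. *)
Definition aug_points (K : set 'cV[R]_d) (y : option 'I_d -> R) : Prop :=
  exists x s, [/\ K x, l2norm (A *m x) = 1, s ^+ 2 <= 1 & y = aug_vec x s].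

Lemma sum_unit_residual : \sum_i (r i / g) ^+ 2 <= 1.
Proof.
have r2 : 0 <= \sum_i r i ^+ 2 by apply: sumr_ge0 => i _; exact: sqr_ge0.
have -> : \sum_i (r i / g) ^+ 2 = (\sum_i r i ^+ 2) / g ^+ 2.
  by rewrite mulr_suml; apply: eq_bigr => i _; rewrite exprMn exprVn.
rewrite sqr_sqrtr //; have [->|z] := eqVneq (\sum_i r i ^+ 2) 0; first by rewrite mul0r.
by rewrite mulfV.
Qed.

Lemma residual_unit i : g * (r i / g) = r i.
Proof.
have [g0|g0] := eqVneq g 0; last by rewrite mulrC divfK.
have r2 : \sum_i r i ^+ 2 = 0.
  have /eqP := g0; rewrite sqrtr_eq0 => h; apply/eqP; rewrite eq_le h.
  by apply: sumr_ge0 => k _; exact: sqr_ge0.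
have /(_ i isT) /eqP := psumr_eq0P (fun i _ => sqr_ge0 (r i)) r2.
by rewrite sqrf_eq0 => /eqP ->; rewrite mul0r mulr0.
Qed.

Lemma aug_block_le l :
  \sum_(k | omap blk k == l) \sum_i aug_mx i k ^+ 2 <= S ^+ 2.
Proof.
rewrite sum_option /=; case: l => [l|] /=.
  by rewrite add0r; exact: block_le_norm.
rewrite [X in _ + X]big_pred0 // addr0.
under eq_bigr do rewrite exprMn.
by rewrite -mulr_sumr ler_piMr ?sqr_ge0 ?sum_unit_residual.
Qed.

Hypothesis S_gt0 : 0 < S.

Lemma dot_aug i x s : dot (aug_mx i) (aug_vec x s) = (A *m x) i 0 + s * (r i / g).
Proof.
rewrite /dot sum_option /= mxE addrC; congr (_ + _).
by move: (r i / g) => c; field; rewrite gt_eqF.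
Qed.

Lemma aug_scale K y : aug_points K y -> \sum_i dot (aug_mx i) y ^+ 2 <= 4.
Proof.
case=> x [s [_ Ax s1 ->]]; under eq_bigr do rewrite dot_aug.
apply: (@le_trans _ _ (\sum_i (2 * (A *m x) i 0 ^+ 2 + 2 * s ^+ 2 * (r i / g) ^+ 2))).
  apply: ler_sum => i _; set a := _ i 0; set c := r i / g.
  by have := sqr_ge0 (a - s * c); rewrite -subr_ge0; lra.
rewrite big_split /= -!mulr_sumr -l2norm_sqr Ax expr1n.
have u1 := sum_unit_residual.
have : s ^+ 2 * (\sum_i (r i / g) ^+ 2) <= 1 * 1.
  apply: ler_pM => //; first exact: sqr_ge0.
  by apply: sumr_ge0 => i _; exact: sqr_ge0.
by lra.
Qed.

(** The added coordinate at most doubles the norm, since [|A x| = 1] forces [1 / S] to be at most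
    the (2,1)-norm of [x]. *)
Lemma aug_norm K y (R0 : R) : (forall x, K x -> l2norm (A *m x) = 1 -> norm21 blk x <= R0) ->
  aug_points K y -> sum_norm (omap blk) y <= 2 * R0.
Proof.
move=> hR [x [s [Kx Ax s1 ->]]]; have xR := hR _ Kx Ax.
rewrite /sum_norm sum_option /=.
have -> : \sum_(l : 'I_b) Num.sqrt (block_sq (omap blk) (aug_vec x s) (Some l)) = norm21 blk x.
  apply: eq_bigr => l _; congr Num.sqrt; rewrite /block_sq sum_option /= add0r.
  by apply: eq_bigl.
have -> : block_sq (omap blk) (aug_vec x s) None = (s / S) ^+ 2.
  by rewrite /block_sq sum_option /= big_pred0 // addr0.
have x0 : 0 <= norm21 blk x by apply: sumr_ge0 => l _; exact: sqrtr_ge0.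
have Sx : 1 <= S * norm21 blk x.
  rewrite -(@expr_ge1 _ 2) ?mulr_ge0 ?(ltW S_gt0) // exprMn.
  by have := l2norm_mulmx_le x; rewrite Ax expr1n.
have : Num.sqrt ((s / S) ^+ 2) <= norm21 blk x.
  apply: sqrt_le_of_sqr => //; rewrite exprMn exprVn ler_pdivrMr ?exprn_gt0 //.
  apply: le_trans s1 _; rewrite -exprMn mulrC expr_ge1 //.
  by rewrite mulr_ge0 // ltW.
by lra.
Qed.

End Augmented.

(** * Recovering the form and the cross term on the cone *)

Section Transfer.
Context {R : realType} (n d b : nat) (blk : 'I_d -> 'I_b) (A : 'M[R]_(n, d)) (r : 'I_n -> R).
Context (K : set 'cV[R]_d) (m eps : R) (e th : {ffun 'I_n -> bool}).
Hypothesis S_gt0 : 0 < block_norm blk A.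
Hypothesis good : forall y, aug_points blk A K y ->
  `|sketch_form m e th (fun i => dot (aug_mx blk A r i) y) -
    \sum_i dot (aug_mx blk A r i) y ^+ 2| <= eps.

Let g := Num.sqrt (\sum_i r i ^+ 2).

(** The lower bound is the case [s = 0]. Subtracting the estimates for [s = 1] and [s = -1] cancels
    the squares and controls the cross term with the normalized residual, which is then multiplied
    by [g]. *)
Lemma sketch_on_cone (x : 'cV[R]_d) (u := fun i => (A *m x) i 0) :
  K x -> l2norm (A *m x) = 1 ->
  1 - eps <= sketch_form m e th u /\ sketch_bil m e th u r <= \sum_i u i * r i + eps * g.
Proof.
move=> Kx Ax; pose c i := r i / g.
have u1 : \sum_i u i ^+ 2 = 1 by rewrite -l2norm_sqr Ax expr1n.
have H s : s ^+ 2 <= 1 -> `|sketch_form m e th u + 2 * s * sketch_bil m e th u c +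
    s ^+ 2 * sketch_form m e th c -
    (1 + 2 * s * (\sum_i u i * c i) + s ^+ 2 * \sum_i c i ^+ 2)| <= eps.
  move=> s1; have := @good (aug_vec blk A x s) _.
  have augE i : dot (aug_mx blk A r i) (aug_vec blk A x s) = u i + s * c i by exact: dot_aug.
  have -> : (fun i => dot (aug_mx blk A r i) (aug_vec blk A x s)) = (fun i => u i + s * c i).
    exact/funext.
  rewrite sketch_formD.
  have -> : \sum_i dot (aug_mx blk A r i) (aug_vec blk A x s) ^+ 2 =
      \sum_i u i ^+ 2 + 2 * s * (\sum_i u i * c i) + s ^+ 2 * \sum_i c i ^+ 2.
    rewrite !mulr_sumr -!big_split; apply: eq_bigr => i _ /=.
    by rewrite augE; ring.
  by rewrite u1; apply; exists x, s.
have ge0 : 0 <= g := sqrtr_ge0 _.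
split.
  have := H 0; rewrite expr0n => /(_ ler01).
  by rewrite !mulr0 !mul0r !addr0 ler_norml => /andP[h _]; lra.
have rE : sketch_bil m e th u r = g * sketch_bil m e th u c.
  rewrite -[g in RHS]mul1r -sketch_bilZ; congr (sketch_bil _ _ _ _ _).
    by apply/funext => i; rewrite mul1r.
  by apply/funext => i; rewrite residual_unit.
have sE : \sum_i u i * r i = g * \sum_i u i * c i.
  by rewrite mulr_sumr; apply: eq_bigr => i _; rewrite mulrCA residual_unit.
rewrite rE sE mulrC [eps * g]mulrC -mulrDr [leLHS]mulrC; apply: ler_wpM2l => //.
have := H 1; rewrite expr1n => /(_ (lexx _)).
have := H (-1); rewrite sqrrN expr1n => /(_ (lexx _)).
rewrite !ler_norml => /andP[a1 a2] /andP[a3 a4].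
have ep0 : 0 <= eps by lra.
by lra.
Qed.

Lemma sketch_on_ray (z : 'cV[R]_d) (v := fun i => (A *m z) i 0) :
  (forall t : R, 0 <= t -> K (t *: z)) ->
  (1 - eps) * \sum_i v i ^+ 2 <= sketch_form m e th v /\
  sketch_bil m e th v r <= \sum_i v i * r i + eps * (Num.sqrt (\sum_i v i ^+ 2) * g).
Proof.
move=> Kz; pose a := l2norm (A *m z).
have a0 : 0 <= a := sqrtr_ge0 _.
have a2 : a ^+ 2 = \sum_i v i ^+ 2 by rewrite l2norm_sqr.
have -> : Num.sqrt (\sum_i v i ^+ 2) = a by rewrite -a2 sqrtr_sqr ger0_norm.
(* If [a = 0] then [a^-1 = 0] and [v = 0], so [v = a * u] holds in this case too. *)
pose x := a^-1 *: z; pose u i := (A *m x) i 0.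
have vE : v = (fun i => a * u i).
  apply/funext => i; rewrite /u /x -scalemxAr mxE -/(v i) mulrA.
  have [az|an0] := eqVneq a 0; last by rewrite mulfV ?mul1r.
  have z2 : \sum_i v i ^+ 2 = 0 by rewrite -a2 az expr0n.
  have /(_ i isT) /eqP := psumr_eq0P (fun i _ => sqr_ge0 (v i)) z2.
  by rewrite sqrf_eq0 => /eqP ->; rewrite mulr0.
have fE : sketch_form m e th v = a ^+ 2 * sketch_form m e th u.
  by rewrite vE -!sketch_bil_diag sketch_bilZ expr2.
have bE : sketch_bil m e th v r = a * sketch_bil m e th u r.
  rewrite vE -[a in RHS]mulr1 -sketch_bilZ; congr (sketch_bil _ _ _ _ _).
  by apply/funext => i; rewrite mul1r.
have sE : \sum_i v i * r i = a * \sum_i u i * r i.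
  by rewrite mulr_sumr; apply: eq_bigr => i _; rewrite vE mulrA.
rewrite fE bE sE -a2.
have [->|an0] := eqVneq a 0; first by rewrite expr0n !mul0r !mulr0 addr0.
have Ax : l2norm (A *m x) = 1.
  apply/eqP; rewrite -(@eqrXn2 _ 2) ?sqrtr_ge0 // expr1n l2norm_sqr.
  have : \sum_i v i ^+ 2 = a ^+ 2 * \sum_i u i ^+ 2.
    by rewrite mulr_sumr; apply: eq_bigr => i _; rewrite vE exprMn.
  by rewrite -a2 => /esym; rewrite -[RHS]mulr1 => /mulfI ->; rewrite ?expf_neq0.
have Kx : K x by apply: Kz; rewrite invr_ge0.
have [lo hi] := sketch_on_cone Kx Ax; split.
  by rewrite mulrC ler_wpM2l ?sqr_ge0.
by rewrite [eps * _]mulrCA -mulrDr ler_wpM2l.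
Qed.

End Transfer.

Lemma tangent_cone_ray (R : realType) (d : nat) (C : set 'cV[R]_d) (x y : 'cV[R]_d) (t : R) :
  C y -> 0 <= t -> tangent_cone C x (t *: (y - x)).
Proof.
move=> Cy t0 G [[_ _ _ scal] sub]; apply: scal => //; apply: sub; by exists y.
Qed.

Lemma beta_factor_gt0 (R : realType) (n b d : nat) (eta : R) : 0 < beta_factor n b d eta.
Proof.
have Ln := @log1_ge1 R n; have Lb := @log1_ge1 R b; have Ld := @log1_ge1 R d.
rewrite /beta_factor !mulr_gt0 ?exprn_gt0 //; try lra.
by have := sqr_ge0 (ln eta^-1); lra.
Qed.

(** * Assembly of the probabilistic and deterministic estimates *)

Theorem theoremC7 (R : realType) :
  exists K : R, 0 < K /\
  forall (n d b D : nat) (blk : 'I_d -> 'I_b)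
    (A : 'M[R]_(n, d)) (b' : 'cV[R]_n) (C : set 'cV[R]_d) (xstar : 'cV[R]_d)
    (eps eta m : R)
    (disp : measure_display) (T : measurableType disp) (P : probability T R)
    (sigma theta : 'I_n -> {RV P >-> R}),
  d = (b * D)%N ->
  block_partition D blk ->
  closed C -> convex_set C ->
  is_minimizer (lsq A b') C xstar ->
  0 < eps < 1 / 2 -> 0 < eta < 1 ->
  0 < m <= n%:R ->
  fjlt_randomness m sigma theta ->
  ((K * beta_factor n b d eta * eps ^- 2 * block_norm blk A ^+ 2)%:E
     * cone_sup blk A (tangent_cone C xstar) <= m%:E)%E ->
  ((1 - eta)%:E <=
   P [set w | forall xhat : 'cV[R]_d,
        is_minimizer
          (sketched_lsq (fjlt m (fun i => sigma i w) (fun i => theta i w)) A b')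
          C xhat ->
        (lsq A b' xhat <= (1 - eps) ^- 2 * lsq A b' xstar)%R])%E.
Proof.
have := @sketch_parameters R; have := @sketch_constant_gt0 R.
move: (@sketch_constant R) => c c0 params; exists c; split=> //.
move=> n d b D blk A b' C xs eps eta m disp T P sigma theta _ _ _ cC mins.
move=> /andP[eps0 eps2] eta01 /andP[m0 mn] rand hm.
have eps1 : 0 < eps < 1 by lra.
have n0 : (0 < n)%N by rewrite -(ltr0n R); exact: lt_le_trans mn.
pose Ev (s t : 'I_n -> R) := forall xhat : 'cV[R]_d,
  is_minimizer (sketched_lsq (fjlt m s t) A b') C xhat ->
  lsq A b' xhat <= (1 - eps) ^- 2 * lsq A b' xs.
apply: (fjlt_probability (Ev := Ev) rand).
pose bad (k : {ffun 'I_n -> bool} * {ffun 'I_n -> bool}) :=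
  `[< ~ Ev (fun i => sgn (k.1 i)) (fun i => (k.2 i)%:R) >].
rewrite (eq_bigl bad) //.
pose r i := (b' - A *m xs) i 0.
pose K := tangent_cone C xs.
pose S := block_norm blk A.
have badP (k : {ffun 'I_n -> bool} * {ffun 'I_n -> bool}) : bad k ->
    exists xh, [/\ C xh, is_minimizer (fun x => sketch_form m k.1 k.2
      (fun i => (A *m x - b') i 0)) C xh &
      ~ lsq A b' xh <= (1 - eps) ^- 2 * lsq A b' xs].
  move=> /asboolP /existsNP[xh /not_implyP[[Ch minh] nle]]; exists xh; split=> //.
  split=> // y Cy; have := minh y Cy.
  by rewrite !sketched_lsq_form.
have ray xh : C xh -> forall t : R, 0 <= t -> K (t *: (xh - xs)).
  by move=> Ch t t0; exact: tangent_cone_ray.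
(* If the cone has no normalized point, then [A] maps every point of [C] to the image of [xs], and
   no pattern is bad. *)
have [[x0 [Kx0 Ax0]]|noX] := pselect (exists x, K x /\ l2norm (A *m x) = 1); last first.
  rewrite big_pred0; first by case/andP: eta01 => /ltW.
  move=> k; apply/negbTE/negP => /badP[xh [Ch minh]]; apply.
  have v0 : l2norm (A *m (xh - xs)) = 0.
    apply/eqP/negPn/negP => vn0; apply: noX.
    have v1 : 0 < l2norm (A *m (xh - xs)) by rewrite lt_neqAle eq_sym vn0 sqrtr_ge0.
    exists ((l2norm (A *m (xh - xs)))^-1 *: (xh - xs)).
    split; first by apply: ray => //; rewrite invr_ge0 ltW.
    apply/eqP; rewrite -(@eqrXn2 _ 2) ?sqrtr_ge0 // expr1n l2norm_sqr -scalemxAr.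
    under eq_bigr do rewrite mxE exprMn.
    by rewrite -mulr_sumr -l2norm_sqr exprVn mulVf // expf_neq0.
  have AE : A *m xh = A *m xs.
    apply/eqP; rewrite -subr_eq0 -mulmxBr; apply/eqP/colP => i; rewrite [RHS]mxE.
    have z2 : \sum_i (A *m (xh - xs)) i 0 ^+ 2 = 0 by rewrite -l2norm_sqr v0 expr0n.
    have /(_ i isT) /eqP := psumr_eq0P (fun i _ => sqr_ge0 _) z2.
    by rewrite sqrf_eq0 => /eqP.
  rewrite {1}/lsq AE -/(lsq A b' xs) ler_peMl ?sqr_ge0 //.
  have [p0 p1] : 0 < 1 - eps /\ 1 - eps <= 1 by split; lra.
  by rewrite invf_ge1 ?exprn_gt0 // expr_le1 // ltW.
(* The normalized point forces [S], [d] and [b] to be positive. *)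
have Sx := l2norm_mulmx_le blk A x0; rewrite Ax0 expr1n -/S in Sx.
have S0 : 0 <= S := block_norm_ge0 blk A.
have Sgt0 : 0 < S.
  by rewrite lt_neqAle S0 andbT eq_sym; apply/eqP => S00; move: Sx; rewrite S00 expr0n mul0r ler10.
have nx0 : 0 <= norm21 blk x0 by apply: sumr_ge0 => l _; exact: sqrtr_ge0.
have x0n : norm21 blk x0 != 0.
  by apply/eqP => x00; move: Sx; rewrite x00 expr0n mulr0 ler10.
have [k0 _] : exists k : 'I_d, True.
  apply: contrapT => nk; move/eqP: x0n; apply; rewrite /norm21 big1 // => l _.
  by rewrite big1 ?sqrtr0 // => k _; case: nk; exists k.
have d0 : (0 < d)%N by apply: leq_ltn_trans (ltn_ord k0).
have b0 : (0 < b)%N by apply: leq_ltn_trans (ltn_ord (blk k0)).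
have [kk [nu [T0 [q [q1 [[nuP KP T0P] [q0 q10] tail par]]]]]] :=
  params n b d eta n0 b0 d0 eta01.
pose coef := c * beta_factor n b d eta * eps ^- 2 * S ^+ 2.
have coef0 : 0 < coef.
  apply: mulr_gt0; last exact: exprn_gt0.
  apply: mulr_gt0; last by rewrite invr_gt0 exprn_gt0.
  exact: mulr_gt0 c0 (beta_factor_gt0 _ _ _ _).
have supge x : K x -> l2norm (A *m x) = 1 ->
    ((norm21 blk x ^+ 2)%:E <= cone_sup blk A K)%E.
  by move=> Kx Ax; apply: ereal_sup_ubound; exists x.
(* An infinite supremum would contradict the lower bound on [m], as its coefficient is positive. *)
have [R2 R2E] : exists R2 : R, cone_sup blk A K = R2%:E.
  move: hm (supge _ Kx0 Ax0); rewrite -/S -/coef -/K.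
  case: (cone_sup _ _ _) => [R2 _ _|h _|_ h]; [by exists R2| |].
    by move: h; rewrite gt0_muley ?lte_fin //.
  by [].
have R2ge x : K x -> l2norm (A *m x) = 1 -> norm21 blk x ^+ 2 <= R2.
  by move=> Kx Ax; rewrite -lee_fin -R2E supge.
have R20 : 0 < R2.
  by apply: lt_le_trans (R2ge _ Kx0 Ax0); rewrite exprn_gt0 // lt_neqAle eq_sym x0n.
have mR2 : coef * R2 <= m by move: hm; rewrite -/S -/coef -/K R2E -EFinM lee_fin.
pose R0 := Num.sqrt R2; have R00 : 0 < R0 by rewrite sqrtr_gt0.
have R0sq : R0 ^+ 2 = R2 by rewrite sqr_sqrtr // ltW.
pose M := Num.sqrt (16 * q1%:R * S ^+ 2).
have M2 : 0 < 16 * q1%:R * S ^+ 2 by rewrite !mulr_gt0 ?exprn_gt0 ?ltr0n.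
have Msq : M ^+ 2 = 16 * q1%:R * S ^+ 2 by rewrite sqr_sqrtr // ltW.
have M0 : 0 < M by rewrite sqrtr_gt0.
have rho0 : 0 < 2 * R0 by rewrite mulr_gt0.
(* The factors [eps ^- 2], [S ^+ 2] and [R2] match on both sides; the doubled radius produces the 4
   in [par]. *)
have mP : 96 * chain_factor kk nu T0 q * (M * (2 * R0)) ^+ 2 <= eps ^+ 2 * m.
  have e2 : 0 < eps ^+ 2 by rewrite exprn_gt0.
  apply: (@le_trans _ _ (eps ^+ 2 * (coef * R2))); last by rewrite ler_wpM2l // ltW.
  have -> : eps ^+ 2 * (coef * R2) =
      c * beta_factor n b d eta * (S ^+ 2 * R2).
    rewrite /coef; set c1 := c * _; move: (S ^+ 2) => S2.
    by field; rewrite gt_eqF.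
  have -> : (M * (2 * R0)) ^+ 2 = (16 * q1%:R * 4) * (S ^+ 2 * R2).
    by rewrite !exprMn Msq R0sq; ring.
  rewrite mulrA; apply: ler_wpM2r par.
  by rewrite mulr_ge0 ?sqr_ge0 ?(ltW R20).
have eps01' : 0 < eps <= 1 by lra.
have card_b : #|{: option 'I_b}| = b.+1 by rewrite card_option card_ord.
have card_d : #|{: option 'I_d}| = d.+1 by rewrite card_option card_ord.
have KP' : (#|{: option 'I_d}| <= 2 ^ kk <= 2 * #|{: option 'I_d}|)%N by rewrite card_d.
have T0P' : 12 * (1 + ln #|{: option 'I_b}|%:R) < T0%:R :> R by rewrite card_b.
have normX y : aug_points blk A K y -> sum_norm (omap blk) y <= 2 * R0.
  apply: aug_norm => // x Kx Ax; rewrite -[leLHS]ger0_norm; last first.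
    by apply: sumr_ge0 => l _; exact: sqrtr_ge0.
  by rewrite -sqrtr_sqr ler_wsqrtr // R2ge.
have fp := @failure_probability R n m _ _ (omap blk) None (aug_mx blk A r) S M (2 * R0)
  (aug_points blk A K) eps kk nu T0 q q1 m0 mn M0 rho0 eps01' (aug_block_le blk A r)
  Msq q10 q0 normX (fun y => @aug_scale _ _ _ _ blk A r Sgt0 K y) nuP KP' T0P' mP.
(* It remains to see that every bad pattern is a failure for the augmented points. *)
apply: le_trans (le_trans fp _); last by rewrite card_b.
rewrite big_mkcond [leRHS]big_mkcond; apply: ler_sum => k _.
have p01 : 0 <= m / n%:R <= 1.
  have n0' : 0 < n%:R :> R by rewrite ltr0n.
  by rewrite divr_ge0 ?(ltW m0) //= ler_pdivrMr // mul1r.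
have h01 : 0 <= (2^-1 : R) <= 1 by lra.
have w0 : 0 <= bern 2^-1 k.1 * bern (m / n%:R) k.2 by rewrite mulr_ge0 ?bern_ge0.
case: ifPn => [/badP[xh [Ch minh nle]]|_]; last by case: ifP.
case: ifPn => // /asboolPn nofail; case: nle.
have good y : aug_points blk A K y ->
    `|sketch_form m k.1 k.2 (fun i => dot (aug_mx blk A r i) y) -
      \sum_i dot (aug_mx blk A r i) y ^+ 2| <= eps.
  move=> Xy; rewrite leNgt; apply/negP => h; apply: nofail; by exists y.
have [lo hi] := sketch_on_ray Sgt0 good (ray _ Ch).
exact: (lsq_le_of_sketch cC mins minh eps1 lo hi).
Qed.
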